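(* Let $d\ge 4$ be even and let $p\ge \frac{12d-8}{9d-12}$. Then $R^*(p\to 4)\lessapprox 1$ for the spheres $S_j\subset \mathbb{F}_q^d$, $j\in\mathbb{F}_q^*$; that is, for every $\varepsilon>0$ there is a constant $C_\varepsilon$ (independent of $q$ and of $j$) such that for every odd prime power $q$, every $j\in\mathbb{F}_q^*$ and every $f:S_j\to\mathbb{C}$, $$\|\widehat{f d\sigma}\|_{L^4(\mathbb{F}_q^d,dm)}\le C_\varepsilon\, q^{\varepsilon}\,\|f\|_{L^p(S_j,d\sigma)}.$$
   Context: $\mathbb{F}_q$ is the finite field with $q$ elements, where $q$ is a power of an odd prime; $\mathbb{F}_q^*=\mathbb{F}_q\setminus\{0\}$. For $x\in\mathbb{F}_q^d$ put $\|x\|_2=x_1^2+\dots+x_d^2\in\mathbb{F}_q$, and for $j\in\mathbb{F}_q^*$ let $S_j=\{x\in\mathbb{F}_q^d:\|x\|_2=j\}$. Fix a non-trivial additive character $\chi:\mathbb{F}_q\to\mathbb{C}$, and let $x\cdot m$ be the usual dot product. With $d\sigma$ the normalized surface measure on $S=S_j$, for $f:S\to\mathbb{C}$ define $$\widehat{fd\sigma}(m)=\frac1{|S|}\sum_{x\in S}\chi(-x\cdot m)f(x)\quad(m\in\mathbb{F}_q^d),$$ $$\|f\|_{L^p(S,d\sigma)}^p=\frac1{|S|}\sum_{x\in S}|f(x)|^p,\qquad \|g\|_{L^r(\mathbb{F}_q^d,dm)}^r=\sum_{m\in\mathbb{F}_q^d}|g(m)|^r$$ for $1\le p,r<\infty$,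 and $\|\cdot\|_{L^\infty}$ denotes the maximum of the absolute value. $R^*(p\to r)$ is the smallest constant such that $\|\widehat{fd\sigma}\|_{L^r(\mathbb{F}_q^d,dm)}\le R^*(p\to r)\|f\|_{L^p(S,d\sigma)}$ for all functions $f$ on $S$. $X\lessapprox Y$ means that for every $\varepsilon>0$ there is $C_\varepsilon$ independent of $q$ with $X\le C_\varepsilon q^\varepsilon Y$. *)

(* Defs.v *)
From HB Require Import structures.
From mathcomp Require Import all_boot all_order all_algebra.
From mathcomp Require Import complex.
From mathcomp Require Import mathcomp_extra boolp classical_sets functions.
From mathcomp Require Import reals ereal exp.

Set Implicit Arguments.
Unset Strict Implicit.
Unset Printing Implicit Defensive.

Import Order.TTheory GRing.Theory Num.Theory.

Local Open Scope ring_scope.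

Definition sqnorm (F : finFieldType) (d : nat) (x : 'rV[F]_d) : F :=
  \sum_(i < d) x ord0 i ^+ 2.

Definition dotp (F : finFieldType) (d : nat) (x m : 'rV[F]_d) : F :=
  \sum_(i < d) x ord0 i * m ord0 i.

Definition sphere (F : finFieldType) (d : nat) (j : F) : {set 'rV[F]_d} :=
  [set x | sqnorm x == j].

Definition sphere_pt (F : finFieldType) (d : nat) (j : F) :=
  {x : 'rV[F]_d | x \in sphere d j}.

(* The values are automatically nonzero (indeed of modulus 1), because
   [chi x * chi (- x) = chi 0 = 1]. *)
Definition additive_character (R : realType) (F : finFieldType)
    (chi : F -> R[i]) : Prop :=
  chi 0 = 1 /\ forall x y : F, chi (x + y) = chi x * chi y.

Definition nontrivial_additive_character (R : realType) (F : finFieldType)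
    (chi : F -> R[i]) : Prop :=
  additive_character chi /\ exists x : F, chi x <> 1.

(* [Normc.normc] is the real-valued modulus; the norm [`|z|] of [z : R[i]]
   is itself an element of [R[i]].  The value at the exponent [-oo] is junk. *)
Definition Lnorm_weighted (R : realType) (T : finType) (w : R) (p : \bar R)
    (g : T -> R[i]) : R :=
  match p with
  | EFin r => (w * \sum_(x : T) Normc.normc (g x) `^ r) `^ r^-1
  | EPInf => \big[Num.max/0]_(x : T) Normc.normc (g x)
  | ENInf => 0
  end.

Definition Lnorm_surface (R : realType) (F : finFieldType) (d : nat) (j : F)
    (p : \bar R) (f : sphere_pt d j -> R[i]) : R :=
  Lnorm_weighted (#|sphere d j|%:R^-1) p f.

Definition Lnorm_counting (R : realType) (F : finFieldType) (d : nat)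
    (r : \bar R) (g : 'rV[F]_d -> R[i]) : R :=
  Lnorm_weighted 1 r g.

Definition extension (R : realType) (F : finFieldType) (chi : F -> R[i])
    (d : nat) (j : F) (f : sphere_pt d j -> R[i]) (m : 'rV[F]_d) : R[i] :=
  #|sphere d j|%:R^-1 *
    \sum_(x : sphere_pt d j) chi (- dotp (val x) m) * f x.

(* [R^*(p -> r)].  The infimum is taken in [\bar R], so it would be [+oo], not
   [0], if no constant were admissible. *)
Definition Rstar (R : realType) (F : finFieldType) (chi : F -> R[i])
    (d : nat) (j : F) (p r : \bar R) : \bar R :=
  ereal_inf [set K%:E | K in
    [set K : R | 0 <= K /\ forall f : sphere_pt d j -> R[i],
       Lnorm_counting r (extension chi f) <= K * Lnorm_surface p f]%classic]%classic.

(* Main.v *)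
(* Since the inner products of [x, y, z] on the sphere determine [sqnorm (x + y - z)], the
   additive energy [L] of a subset [E] of [S_j], [s] points, is at most the number of triples
   [(x, z, y)] of [E] with [y] on the hyperplane [y . m + |m| / 2 = 0], where [m = x - z] and
   [|m| = sqnorm m].
   This incidence count is compared with its mean [s ^ 3 / q] by two Cauchy-Schwarz
   arguments: over [y] in [S_j] when [|m| <> 0], over the isotropic cone in [m] when
   [|m| = 0].  Both lead to the correlation of two hyperplanes along a quadric.  In even
   dimension [d] the Gauss sum of [sqnorm] does not depend on the frequency, so the sum over
   the frequencies just counts the zeros of a nonzero polynomial of degree at most 2 in two
   variables, and the correlation is [O(q ^ (d / 2 - 1))] however degenerate the two
   hyperplanes are (no Kloosterman sum is needed).  Hence
     [L = O(s ^ 3 / q + s ^ (5 / 2) * q ^ ((d - 2) / 4) + s ^ 2 * q ^ ((d - 2) / 2)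
            + s * q ^ (d - 2))],
   which together with [L <= s ^ 3] gives the restricted estimate for indicator functions;
   a dyadic decomposition with [O(log q)] levels yields all functions. *)
Require Import Defs.
From mathcomp Require Import all_boot all_order all_algebra.
From mathcomp Require Import complex.
From mathcomp Require Import mathcomp_extra boolp classical_sets functions.
From mathcomp Require Import reals ereal exp.
From mathcomp Require Import ring lra.
From mathcomp Require Import fintype finset.
Set Implicit Arguments.
Unset Strict Implicit.
Unset Printing Implicit Defensive.
Import Order.TTheory GRing.Theory Num.Theory.
Local Open Scope ring_scope.

(** The sum of all nontrivial additive characters of [F] at [v], that is, [q] times the indicator of
    [v = 0], centred to have mean zero. The ring is a parameter because values are needed both in
    [R] and in [R[i]]. *)
Definition balanced_delta (A : pzRingType) (F : finFieldType) (v : F) : A :=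
  #|F|%:R * (v == 0)%:R - 1.

(** * Gauss sums *)

(** Translation by 1 permutes [F], so adding 1 to every element leaves the sum of all elements
    unchanged. *)
Lemma natr_card_eq0 (F : finFieldType) : (#|F|%:R : F) = 0.
Proof.
have : \sum_(x : F) (x + 1) = \sum_(x : F) x.
  by rewrite [RHS](reindex_inj (addIr 1)).
rewrite big_split /= sumr_const => /eqP.
by rewrite -subr_eq0 [_ - _]addrC addKr => /eqP.
Qed.

Section Characters.
Variables (R : realType) (F : finFieldType) (chi : F -> R[i]).
Hypothesis F_odd : odd #|F|.
Hypothesis chi_nontrivial : nontrivial_additive_character chi.
Let q : R[i] := #|F|%:R.

Lemma odd_card_two_neq0 : (2 : F) != 0.
Proof.
apply/negP => /eqP two0.
have card0 := natr_card_eq0 F.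
move: card0; rewrite -[#|F|]odd_double_half F_odd -muln2 natrD natrM two0.
by rewrite mulr0 addr0 => /eqP; rewrite oner_eq0.
Qed.

Lemma char0 : chi 0 = 1. Proof. by case: chi_nontrivial => -[]. Qed.
Lemma charD x y : chi (x + y) = chi x * chi y.
Proof. by case: chi_nontrivial => -[]. Qed.

Lemma char_sum (I : Type) (r : seq I) (P : pred I) (f : I -> F) :
  chi (\sum_(i <- r | P i) f i) = \prod_(i <- r | P i) chi (f i).
Proof. by rewrite (big_morph chi charD char0). Qed.

Lemma sum_char : \sum_x chi x = 0.
Proof.
have [_ [a /eqP chia]] := chi_nontrivial.
have E : chi a * \sum_x chi x = \sum_x chi x.
  rewrite mulr_sumr [RHS](reindex_inj (addrI a)).
  by apply: eq_bigr => x _; rewrite charD.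
apply/eqP; move/eqP: E; rewrite -subr_eq0 -{2}[\sum_x _]mul1r -mulrBl mulf_eq0.
by rewrite subr_eq0 (negPf chia).
Qed.

Lemma sum_charM v : \sum_x chi (x * v) = q * (v == 0)%:R.
Proof.
case: eqVneq => [->|v0].
  under eq_bigr do rewrite mulr0 char0.
  by rewrite sumr_const mulr1.
rewrite mulr0 -[RHS]sum_char [RHS](reindex (fun x => x * v)) //=.
by exists (fun x => x / v) => x _; rewrite ?mulfK ?mulfVK.
Qed.

Lemma balanced_delta_char v :
  balanced_delta _ v = \sum_(x | x != 0) chi (x * v).
Proof.
rewrite /balanced_delta -/q -sum_charM (bigD1 0) //= mul0r char0.
by rewrite addrAC subrr add0r.
Qed.

Lemma sum_charM_neq0 (t : F) : t != 0 -> \sum_x chi (t * x) = 0.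
Proof.
by move=> t0; under eq_bigr do rewrite mulrC; rewrite sum_charM (negPf t0) mulr0.
Qed.

Let gauss (t : F) : R[i] := \sum_x chi (t * x ^+ 2).

(** Substituting [y = x - z] makes the phase linear in [x], so the sum over [x] leaves only
    [z = 0]. *)
Lemma gaussMN t : t != 0 -> gauss t * gauss (- t) = q.
Proof.
move=> t0; rewrite /gauss mulr_suml.
under eq_bigr do rewrite mulr_sumr.
have -> : \sum_x \sum_y chi (t * x ^+ 2) * chi (- t * y ^+ 2)
  = \sum_x \sum_z chi (z * (t * 2 * x)) * chi (- t * z ^+ 2).
  apply: eq_bigr => x _; rewrite (reindex_inj (addrI x)).
  rewrite (reindex_inj (@oppr_inj F)) /=.
  by apply: eq_bigr => z _; rewrite -!charD; congr chi; ring.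
rewrite exchange_big /=.
under eq_bigr do rewrite -mulr_suml.
rewrite (bigD1 0) //= [X in _ + X]big1 => [|z z0].
  rewrite expr0n /= mulr0 char0 mulr1 addr0.
  under eq_bigr do rewrite mul0r char0.
  by rewrite sumr_const.
under eq_bigr do rewrite mulrA.
rewrite sum_charM_neq0 ?mul0r //.
by rewrite !mulf_neq0 // odd_card_two_neq0.
Qed.

(* For a non-square [l], the squares and the [l]-multiples of squares together
   cover every element exactly twice; for a square [l] one substitutes. *)
Lemma gauss_scale t l : t != 0 -> l != 0 ->
  gauss (t * l) = gauss t \/ gauss (t * l) = - gauss t.
Proof.
move=> t0 l0.
case: (boolP [exists a : F, a ^+ 2 == l]) => [/existsP [a /eqP al]|nsq].
  left; have a0 : a != 0 by apply: contra_neq l0 => a0; rewrite -al a0 expr0n.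
  rewrite /gauss [RHS](reindex_inj (mulfI a0)) /=.
  by apply: eq_bigr => x _; rewrite exprMn al -mulrA.
right.
pose N (v : F) := #|[set x : F | x ^+ 2 == v]|.
have sumN (f : F -> R[i]) : \sum_x f (x ^+ 2) = \sum_v (N v)%:R * f v.
  rewrite (partition_big (fun x : F => x ^+ 2) predT) //=.
  apply: eq_bigr => v _; rewrite -[N v]sum1_card natr_sum mulr_suml.
  rewrite [RHS](eq_bigl (fun x : F => x ^+ 2 == v)); last by move=> x; rewrite inE.
  by apply: eq_bigr => x /eqP ->; rewrite mul1r.
have N0 : N 0 = 1%N.
  rewrite /N (_ : [set _ | _] = [set 0]) ?cards1 //.
  by apply/setP => x; rewrite !inE expf_eq0.
have Nle v : (N v <= 2)%N.
  rewrite /N; case: (set_0Vmem [set x : F | x ^+ 2 == v]) => [->|[a]]; first by rewrite cards0.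
  rewrite inE => /eqP av; apply: leq_trans (_ : #|[set a; - a]| <= 2)%N.
    by apply: subset_leq_card; apply/subsetP => x; rewrite !inE -av eqf_sqr.
  by rewrite cards2; case: (_ != _).
have Nle2 v : (N v + N (v / l) <= 2)%N.
  case: (eqVneq v 0) => [->|v0]; first by rewrite mul0r N0.
  case: (set_0Vmem [set x : F | x ^+ 2 == v]) => [e|[a]].
    by rewrite /N e cards0 add0n Nle.
  rewrite inE => /eqP av; suff -> : N (v / l) = 0%N by rewrite addn0.
  apply/eqP; rewrite cards_eq0 -subset0; apply/subsetP => x.
  rewrite inE => /eqP xv; case/negP: nsq; apply/existsP; exists (a / x).
  by rewrite expr_div_n av xv invf_div mulrCA mulfV ?mulr1.
have sumNE : (\sum_v N v)%N = #|F|.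
  rewrite -[RHS]sum1_card [RHS](partition_big (fun x : F => x ^+ 2) predT) //=.
  apply: eq_bigr => v _; rewrite /N -sum1_card.
  by apply: eq_bigl => x; rewrite inE.
(* Both sides of the termwise inequality [Nle2] have the same sum over [v], so every term is an
   equality. *)
have Neq v : (N v + N (v / l) = 2)%N.
  have sumN2 : (\sum_v (N v + N (v / l)) = \sum_(v : F) 2)%N.
    rewrite big_split /= [X in (_ + X)%N](reindex_inj (mulIf l0)) /=.
    under [X in (_ + X)%N]eq_bigr do rewrite mulfK //.
    by rewrite sumNE sum_nat_const muln2 addnn.
  have /leqif_sum H : forall v : F, true ->
      (N v + N (v / l) <= 2 ?= iff (N v + N (v / l) == 2))%N.
    by move=> w _; exact: leqif_eq.
  have := H.2; rewrite sumN2 eqxx => /esym /forallP /(_ v) /=.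
  by move/eqP.
apply/eqP; rewrite -addr_eq0 /gauss.
have -> : \sum_x chi (t * l * x ^+ 2) = \sum_v (N (v / l))%:R * chi (t * v).
  rewrite (sumN (fun v => chi (t * l * v))) [RHS](reindex_inj (mulIf l0)) /=.
  by apply: eq_bigr => v _; rewrite mulfK // -mulrA [l * v]mulrC.
rewrite (sumN (fun v => chi (t * v))) -big_split /=.
under eq_bigr do rewrite -mulrDl -natrD addnC Neq.
by rewrite -mulr_sumr sum_charM_neq0 // mulr0.
Qed.

(** Each [gauss t] is [gauss 1] up to sign, so all squares equal [gauss 1 ^+ 2]; this is
    [gauss 1 * gauss (- 1) = q] up to the sign relating these two sums. *)
Lemma gauss_sqr : exists b : bool, forall t, t != 0 -> gauss t ^+ 2 = (-1) ^+ b * q.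
Proof.
have N1 : -1 != 0 :> F by rewrite oppr_eq0 oner_neq0.
have [n1|n1] := gauss_scale (oner_neq0 F) N1.
  exists false => t t0; rewrite mul1r.
  rewrite -(mul1r t); have [->|->] := gauss_scale (oner_neq0 F) t0.
    by rewrite -(gaussMN (oner_neq0 F)) -(mul1r (-1)) n1.
  by rewrite sqrrN -(gaussMN (oner_neq0 F)) -(mul1r (-1)) n1.
exists true => t t0.
have g1 : gauss 1 ^+ 2 = - q.
  by rewrite -(gaussMN (oner_neq0 F)) -(mul1r (-1)) n1 mulrN opprK.
rewrite -(mul1r t) expr1 mulN1r -g1.
by have [->|->] := gauss_scale (oner_neq0 F) t0; rewrite ?sqrrN.
Qed.

Variable h : nat.
Let V := 'rV[F]_(h.*2).

(** The sum factors into [2 * h] one-dimensional Gauss sums; being even in number they pair into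
    squares, so no dependence on [t] remains. *)
Lemma gauss_sqnorm : exists b : bool, forall t, t != 0 ->
  \sum_(y : V) chi (t * sqnorm y) = (-1) ^+ b * q ^+ h.
Proof.
have [b gb] := gauss_sqr; exists (b && odd h) => t t0.
have -> : (-1) ^+ (b && odd h) * q ^+ h = \prod_(i < h.*2) gauss t.
  rewrite prodr_const card_ord -muln2 mulnC exprM gb // exprMn -exprM.
  by case: b {gb} => /=; rewrite ?mul1n ?signr_odd ?mul0n.
rewrite (bigA_distr_bigA (fun (i : 'I_(h.*2)) x => chi (t * x ^+ 2))) /=.
rewrite (reindex (fun y : V => [ffun i => y ord0 i])) /=; last first.
  exists (fun f : {ffun 'I_(h.*2) -> F} => \row_i f i) => [y|f] _.
    by apply/rowP => i; rewrite mxE ffunE.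
  by apply/ffunP => i; rewrite ffunE mxE.
apply: eq_bigr => y _; rewrite /sqnorm mulr_sumr char_sum.
by apply: eq_bigr => i _; rewrite ffunE.
Qed.

End Characters.

(** * Bilinear algebra of [dotp] and [sqnorm] *)

Section Quadric.
Variables (F : finFieldType) (d : nat).
Implicit Types x y z : 'rV[F]_d.

Lemma dotpC x y : dotp x y = dotp y x.
Proof. by apply: eq_bigr => i _; rewrite mulrC. Qed.

Lemma dotpDl x y z : dotp (x + y) z = dotp x z + dotp y z.
Proof. by rewrite -big_split; apply: eq_bigr => i _; rewrite mxE mulrDl. Qed.

Lemma dotpDr x y z : dotp x (y + z) = dotp x y + dotp x z.
Proof. by rewrite !(dotpC x) dotpDl. Qed.

Lemma dotpZl a x y : dotp (a *: x) y = a * dotp x y.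
Proof. by rewrite mulr_sumr; apply: eq_bigr => i _; rewrite mxE mulrA. Qed.

Lemma dotpZr a x y : dotp x (a *: y) = a * dotp x y.
Proof. by rewrite !(dotpC x) dotpZl. Qed.

Lemma dotpNl x y : dotp (- x) y = - dotp x y.
Proof. by rewrite -scaleN1r dotpZl mulN1r. Qed.

Lemma dotpNr x y : dotp x (- y) = - dotp x y.
Proof. by rewrite !(dotpC x) dotpNl. Qed.

Lemma dotp0l x : dotp 0 x = 0.
Proof. by rewrite -(scale0r x) dotpZl mul0r. Qed.

Lemma dotpxx x : dotp x x = sqnorm x.
Proof. by apply: eq_bigr => i _; rewrite expr2. Qed.

Lemma sqnormD x y : sqnorm (x + y) = sqnorm x + 2 * dotp x y + sqnorm y.
Proof. by rewrite -!dotpxx dotpDl !dotpDr (dotpC y x); ring. Qed.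

Lemma sqnormZ a x : sqnorm (a *: x) = a ^+ 2 * sqnorm x.
Proof. by rewrite -!dotpxx dotpZl dotpZr mulrA expr2. Qed.

Lemma sqnormN x : sqnorm (- x) = sqnorm x.
Proof. by rewrite -!dotpxx dotpNl dotpNr opprK. Qed.

End Quadric.

(** * Exponential sums over quadrics *)

Section QuadraticSums.
Variables (R : realType) (F : finFieldType) (chi : F -> R[i]).
Hypothesis F_odd : odd #|F|.
Hypothesis chi_nontrivial : nontrivial_additive_character chi.

Lemma sum_char_dotp d (w : 'rV[F]_d) :
  \sum_y chi (dotp y w) = #|F|%:R ^+ d * (w == 0)%:R.
Proof.
rewrite (reindex (fun f : {ffun 'I_d -> F} => \row_i f i)) /=; last first.
  exists (fun y : 'rV[F]_d => [ffun i => y ord0 i]) => [f|y] _.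
    by apply/ffunP => i; rewrite ffunE mxE.
  by apply/rowP => i; rewrite mxE ffunE.
under eq_bigr do rewrite (char_sum chi_nontrivial).
under eq_bigr => f do under eq_bigr do rewrite mxE.
rewrite -(bigA_distr_bigA (fun (i : 'I_d) x => chi (x * w ord0 i))) /=.
under eq_bigr do rewrite (sum_charM chi_nontrivial).
rewrite big_split /= prodr_const card_ord -natr_prod; congr (_ * _%:R).
case: eqVneq => [->|w0]; first by rewrite big1 // => i _; rewrite mxE eqxx.
have [i wi] : exists i, w ord0 i != 0.
  apply/existsP; apply: contraNT w0; rewrite negb_exists => /forallP w0.
  by apply/eqP/rowP => i; rewrite mxE; apply/eqP; have := w0 i; rewrite negbK.
by rewrite (bigD1 i) //= (negPf wi).
Qed.

Lemma balanced_delta_complex (v : F) :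
  (balanced_delta R v)%:C%C = balanced_delta R[i] v.
Proof. by rewrite /balanced_delta rmorphB rmorphM rmorph1 !rmorph_nat. Qed.

Lemma balanced_delta_char_scale (t v : F) : t != 0 ->
  balanced_delta R[i] v = \sum_(s | s != 0) chi (t * s * v).
Proof.
move=> t0; rewrite (balanced_delta_char chi_nontrivial).
rewrite (reindex_inj (mulfI t0)) /=; apply: eq_bigl => s.
by rewrite mulf_eq0 negb_or t0.
Qed.

Variable h : nat.
Let V := 'rV[F]_(h.*2).
Let q : R := #|F|%:R.

(* The double sum on the right is what remains of the nonzero frequencies [t] of
   [sqnorm y = tau], after completing the square and rescaling [s, s'] by [2 * t]. *)
Lemma quadric_correlation : exists b : bool,
  forall (u u' : V) (c c' tau : F),
  q * \sum_(y : V | sqnorm y == tau)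
       balanced_delta R (dotp y u + c) * balanced_delta R (dotp y u' + c') =
  \sum_(y : V) balanced_delta R (dotp y u + c) * balanced_delta R (dotp y u' + c')
  + (-1) ^+ b * q ^+ h * \sum_(s | s != 0) \sum_(s' | s' != 0)
      balanced_delta R (2 * s * c + 2 * s' * c' - tau - sqnorm (s *: u + s' *: u')).
Proof.
have [b gb] := gauss_sqnorm F_odd chi_nontrivial h; exists b => u u' c c' tau.
apply: complexI; rewrite rmorphD !rmorphM /= rmorphXn /= rmorphN1 rmorphXn /= !rmorph_nat.
rewrite !rmorph_sum /=.
under eq_bigr do rewrite rmorphM /= !balanced_delta_complex.
under [X in X + _]eq_bigr do rewrite rmorphM /= !balanced_delta_complex.
under [X in _ + _ * X]eq_bigr => s s0.
  rewrite rmorph_sum /=; under eq_bigr do rewrite balanced_delta_complex.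
  over.
pose kk (y : V) := balanced_delta R[i] (dotp y u + c) * balanced_delta R[i] (dotp y u' + c').
pose P s s' := 2 * s * c + 2 * s' * c' - tau - sqnorm (s *: u + s' *: u').
have Et t : t != 0 -> \sum_y chi (t * (sqnorm y - tau)) * kk y =
    (-1) ^+ b * #|F|%:R ^+ h * \sum_(s | s != 0) \sum_(s' | s' != 0) chi (t * P s s').
  move=> t0; have t20 : 2 * t != 0 by rewrite mulf_neq0 // odd_card_two_neq0.
  rewrite /kk; under eq_bigr do rewrite !(balanced_delta_char_scale _ t20) mulr_suml mulr_sumr.
  rewrite exchange_big mulr_sumr; apply: eq_bigr => s s0 /=.
  under eq_bigr do rewrite !mulr_sumr.
  rewrite exchange_big mulr_sumr; apply: eq_bigr => s' s'0 /=.
  (* This shift completes the square: the phase becomes [t * sqnorm y + t * P s s'], and the sum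
     over [y] is a Gauss sum independent of [t]. *)
  rewrite (reindex_inj (addIr (- (s *: u + s' *: u')))) /=.
  rewrite -(gb _ t0) mulr_suml; apply: eq_bigr => y _.
  rewrite -!(charD chi_nontrivial) /P; congr chi.
  rewrite sqnormD sqnormN dotpNr !dotpDl !dotpNl !dotpDr !dotpDl !dotpZl !dotpZr sqnormD.
  rewrite !sqnormZ !dotpxx !dotpZl !dotpZr (dotpC u' u); ring.
have -> : #|F|%:R * \sum_(y : V | sqnorm y == tau) kk y
   = \sum_t \sum_y chi (t * (sqnorm y - tau)) * kk y.
  rewrite exchange_big mulr_sumr big_mkcond /=; apply: eq_bigr => y _.
  rewrite -mulr_suml (sum_charM chi_nontrivial) subr_eq0.
  by case: ifP; rewrite ?mulr1 ?mulr0 ?mul0r.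
rewrite (bigD1 0) //=; congr (_ + _).
  by apply: eq_bigr => y _; rewrite mul0r (char0 chi_nontrivial) mul1r.
rewrite (eq_bigr _ Et) -mulr_sumr exchange_big /=; congr (_ * _).
apply: eq_bigr => s _; rewrite exchange_big /=; apply: eq_bigr => s' _.
by rewrite (balanced_delta_char chi_nontrivial).
Qed.

End QuadraticSums.

(** * Correlation of hyperplanes along a quadric *)

Lemma card_quadratic_roots (F : finFieldType) (a b c : F) :
  ~~ [&& a == 0, b == 0 & c == 0] ->
  (#|[set x : F | (a * x ^+ 2 + b * x + c == 0)%R]| <= 2)%N.
Proof.
move=> nz; pose p : {poly F} := Poly [:: c; b; a].
have p0 : p != 0.
  apply: contra nz => /eqP p0.
  have co i : p`_i = 0 by rewrite p0 coef0.
  move: (co 0%N) (co 1%N) (co 2%N); rewrite !coef_Poly /= => -> -> ->.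
  by rewrite !eqxx.
have sp : (size p <= 3)%N by exact: size_Poly.
rewrite cardE -ltnS; apply: leq_trans sp; apply: max_poly_roots => //; last exact: enum_uniq.
apply/allP => x; rewrite mem_enum inE => /eqP e.
rewrite /root horner_Poly /=; apply/eqP; rewrite -[RHS]e; ring.
Qed.

Section CorrelationBound.
Variables (R : realType) (F : finFieldType) (chi : F -> R[i]).
Hypothesis F_odd : odd #|F|.
Hypothesis chi_nontrivial : nontrivial_additive_character chi.
Let q : R := #|F|%:R.

Lemma balanced_delta_le (v : F) : balanced_delta R v <= q * (v == 0)%:R.
Proof. by rewrite /balanced_delta gerBl. Qed.

Lemma normr_balanced_delta (v : F) : `|balanced_delta R v| <= q * (v == 0)%:R + 1.
Proof.
apply: le_trans (ler_normB _ _) _.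
by rewrite normr1 ger0_norm // mulr_ge0 // ler0n.
Qed.

(** For fixed [s] the argument is a polynomial of degree at most 2 in [s'], with at most two roots
    unless its coefficients all vanish. The exceptional [s] form [B]: it is empty if [sqnorm u'] is
    nonzero, and otherwise lies in the zeros of the constant coefficient, a quadratic in [s] with
    value [- tau] at 0. So there are at most [2 * q + 2 * q] zeros, each of weight [q], and the
    terms 1 add [q ^+ 2]. *)
Lemma sum_balanced_delta_quadratic d (u u' : 'rV[F]_d) (c c' tau : F) :
  tau != 0 \/ sqnorm u' != 0 ->
  `|\sum_(s | s != 0) \sum_(s' | s' != 0)
      balanced_delta R (2 * s * c + 2 * s' * c' - tau - sqnorm (s *: u + s' *: u'))|
  <= 5 * q ^+ 2.
Proof.
move=> nondeg; pose P s s' := 2 * s * c + 2 * s' * c' - tau - sqnorm (s *: u + s' *: u').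
pose B := [set s : F | [&& - sqnorm u' == 0, 2 * c' - 2 * s * dotp u u' == 0
  & 2 * s * c - tau - s ^+ 2 * sqnorm u == 0]].
have PE s s' : P s s' = - sqnorm u' * s' ^+ 2 + (2 * c' - 2 * s * dotp u u') * s'
    + (2 * s * c - tau - s ^+ 2 * sqnorm u).
  by rewrite /P sqnormD !sqnormZ dotpZl dotpZr; ring.
have cardB : (#|B| <= 2)%N.
  case: nondeg => [tau0|u'0]; last first.
    by rewrite (_ : B = set0) ?cards0 //; apply/setP => s; rewrite !inE oppr_eq0 (negPf u'0).
  apply: leq_trans _ (@card_quadratic_roots F (- sqnorm u) (2 * c) (- tau) _); last first.
    by rewrite (oppr_eq0 tau) (negPf tau0) !andbF.
  apply: subset_leq_card; apply/subsetP => s; rewrite !inE => /and3P [_ _ /eqP e].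
  by apply/eqP; rewrite -e; ring.
have zeros s : (#|[set s' | P s s' == 0%R]| <= 2 + #|F| * (s \in B))%N.
  case: (boolP (s \in B)) => sB.
    by rewrite muln1; apply: leq_trans (max_card _) (leq_addl _ _).
  rewrite muln0 addn0; under eq_finset do rewrite PE.
  by apply: card_quadratic_roots; move: sB; rewrite inE.
apply: le_trans (_ : \sum_(s : F) \sum_(s' : F) (q * (P s s' == 0)%:R + 1) <= _).
  apply: le_trans (ler_norm_sum _ _ _) _; rewrite [X in _ <= X](bigID (fun s => s != 0)) /=.
  rewrite -[X in X <= _]addr0; apply: lerD; last first.
    by do 2![apply: sumr_ge0 => ? _]; rewrite addr_ge0 // mulr_ge0 // ler0n.
  apply: ler_sum => s _; apply: le_trans (ler_norm_sum _ _ _) _.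
  rewrite [X in _ <= X](bigID (fun s => s != 0)) /= -[X in X <= _]addr0; apply: lerD.
    by apply: ler_sum => s' _; exact: normr_balanced_delta.
  by apply: sumr_ge0 => ? _; rewrite addr_ge0 // mulr_ge0 // ler0n.
have rowE s : \sum_(s' : F) (q * (P s s' == 0)%:R + 1) = q * #|[set s' | P s s' == 0]|%:R + q.
  rewrite big_split /= sumr_const -mulr_sumr; congr (_ * _ + _).
  by rewrite -sum1_card natr_sum [RHS]big_mkcond /=; apply: eq_bigr => s' _; rewrite inE; case: ifP.
under eq_bigr do rewrite rowE.
apply: le_trans (_ : \sum_(s : F) (q * (2 + #|F| * (s \in B))%:R + q) <= _).
  by apply: ler_sum => s _; rewrite lerD2r ler_wpM2l ?ler0n // ler_nat.
rewrite big_split /= sumr_const -mulr_sumr -natr_sum big_split /= sum_nat_const -big_distrr /=.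
rewrite -big_mkcondr /= sum1_card -mulr_natr -/q natrD !natrM -/q.
have : (#|B|%:R : R) <= 2 by rewrite ler_nat.
have q0 : 0 <= q by exact: ler0n.
move: (#|B|%:R : R) => b b2; nra.
Qed.

(** Orthogonality in [y] keeps only the frequencies with [s *: u + s' *: u' = 0], which exist only
    for [u' = l *: u]. Then [s = - (s' * l)], and the sum over [s'] is [balanced_delta] of
    [c' - l * c], negative unless the two hyperplanes coincide. *)
Lemma linear_correlation_le d (u u' : 'rV[F]_d) (c c' : F) : u != 0 ->
  \sum_y balanced_delta R (dotp y u + c) * balanced_delta R (dotp y u' + c')
  <= q ^+ d.+1 * [exists l : F, [&& l != 0, u' == l *: u & c' == l * c]]%:R.
Proof.
move=> u0.
have E : (\sum_y balanced_delta R (dotp y u + c) * balanced_delta R (dotp y u' + c'))%:C%C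
  = #|F|%:R ^+ d * \sum_(s | s != 0) \sum_(s' | s' != 0)
      (s *: u + s' *: u' == 0)%:R * chi (s * c + s' * c').
  rewrite rmorph_sum /=.
  under eq_bigr do rewrite rmorphM /= !balanced_delta_complex
    !(balanced_delta_char chi_nontrivial) mulr_suml.
  rewrite exchange_big mulr_sumr; apply: eq_bigr => s s0 /=.
  under eq_bigr do rewrite mulr_sumr.
  rewrite exchange_big mulr_sumr; apply: eq_bigr => s' s'0 /=.
  rewrite mulrA -(sum_char_dotp chi_nontrivial) mulr_suml; apply: eq_bigr => y _.
  rewrite -!(charD chi_nontrivial); congr chi.
  by rewrite dotpDr !dotpZr; ring.
have [/existsP [l /andP [l0 /eqP u'E]]|npar] := boolP [exists l : F, (l != 0) && (u' == l *: u)].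
  have -> : \sum_y balanced_delta R (dotp y u + c) * balanced_delta R (dotp y u' + c')
      = q ^+ d * balanced_delta R (c' - l * c).
    apply: complexI; rewrite E rmorphM /= rmorphXn /= rmorph_nat; congr (_ * _).
    rewrite balanced_delta_complex (balanced_delta_char chi_nontrivial) exchange_big /=.
    apply: eq_bigr => s' s'0.
    have E' s : (s *: u + s' *: u' == 0) = (s == - (s' * l)).
      by rewrite u'E scalerA -scalerDl scaler_eq0 (negPf u0) orbF addr_eq0.
    rewrite (bigD1 (- (s' * l))) /=; last by rewrite oppr_eq0 mulf_neq0.
    rewrite E' eqxx mul1r big1 ?addr0 => [|s /andP [_ /negPf ns]].
      by congr chi; ring.
    by rewrite E' ns mul0r.
  rewrite exprSr -mulrA ler_wpM2l ?exprn_ge0 ?ler0n //.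
  apply: le_trans (balanced_delta_le _) _; rewrite ler_wpM2l ?ler0n // ler_nat.
  case: eqVneq => [e|//]; rewrite lt0b; apply/existsP; exists l.
  by rewrite l0 u'E eqxx -subr_eq0 e eqxx.
rewrite (_ : \sum_y _ = 0); first by rewrite mulr_ge0 ?exprn_ge0 ?ler0n.
apply: complexI; rewrite E big1 ?mulr0 // => s s0; rewrite big1 // => s' s'0.
case: eqVneq => [e|_]; last by rewrite mul0r.
case/negP: npar; apply/existsP; exists (- (s'^-1 * s)); rewrite oppr_eq0 mulf_neq0 ?invr_neq0 //=.
apply/eqP; apply: (scalerI s'0); rewrite scalerA mulrN mulrA mulfV // mul1r scaleNr.
by apply/eqP; rewrite -addr_eq0 addrC e.
Qed.

Variable h : nat.
Let V := 'rV[F]_(h.*2).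

Lemma quadric_correlation_le (u u' : V) (c c' tau : F) :
  u != 0 -> tau != 0 \/ sqnorm u' != 0 ->
  \sum_(y : V | sqnorm y == tau)
       balanced_delta R (dotp y u + c) * balanced_delta R (dotp y u' + c')
  <= q ^+ (h.*2) * [exists l : F, [&& l != 0, u' == l *: u & c' == l * c]]%:R
     + 5 * q ^+ h.+1.
Proof.
move=> u0 nondeg.
have q0 : 0 < q by rewrite ltr0n; apply/card_gt0P; exists 0.
rewrite -(ler_pM2l q0).
have [b ->] := quadric_correlation F_odd chi_nontrivial h.
rewrite mulrDr mulrA -exprS; apply: lerD; first exact: linear_correlation_le.
apply: le_trans (ler_norm _) _; rewrite !normrM normrX normrN1 expr1n mul1r.
rewrite ger0_norm ?exprn_ge0 ?ler0n //.
apply: le_trans (ler_wpM2l _ (sum_balanced_delta_quadratic _ _ _ nondeg)) _.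
  by rewrite exprn_ge0 ?ler0n.
by rewrite le_eqVlt; apply/orP; left; apply/eqP; rewrite -/q !exprS; ring.
Qed.

(** Every nonzero frequency [t] contributes the same Gauss sum times [chi (- (t * j))], and these
    characters sum to -1 because [j] is nonzero. *)
Lemma card_sphere_approx (j : F) : j != 0 ->
  `|q * #|sphere (h.*2) j|%:R - q ^+ (h.*2)| <= q ^+ h.
Proof.
move=> j0; have [b gb] := gauss_sqnorm F_odd chi_nontrivial h.
suff -> : q * #|sphere (h.*2) j|%:R - q ^+ (h.*2) = - (-1) ^+ b * q ^+ h.
  by rewrite !normrM normrN !normrX normrN1 expr1n mul1r ger0_norm // ler0n.
apply/eqP; rewrite subr_eq addrC; apply/eqP; apply: complexI.
rewrite rmorphM rmorphD rmorphM rmorphN !rmorphXn rmorphN1 /= !rmorph_nat.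
have -> : #|F|%:R * #|sphere (h.*2) j|%:R
   = \sum_t \sum_(y : V) chi (t * (sqnorm y - j)).
  rewrite exchange_big -sum1_card natr_sum mulr_sumr big_mkcond /=; apply: eq_bigr => y _.
  by rewrite (sum_charM chi_nontrivial) subr_eq0 inE; case: ifP => _; rewrite ?mulr1 ?mulr0.
rewrite (bigD1 0) //=; congr (_ + _).
  under eq_bigr do rewrite mul0r (char0 chi_nontrivial).
  by rewrite sumr_const card_mx mul1n -natrX.
under eq_bigr => t t0.
  under eq_bigr do rewrite mulrBr (charD chi_nontrivial).
  rewrite -mulr_suml gb // -mulrN; over.
rewrite -mulr_sumr -(balanced_delta_char chi_nontrivial) /balanced_delta oppr_eq0 (negPf j0).
by rewrite mulr0 sub0r mulrN1 mulNr.
Qed.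

End CorrelationBound.

(** * Additive energy on the sphere *)

(** Cauchy-Schwarz, from Lagrange's identity. *)
Lemma sum_mul_sqr_le (R : realFieldType) (I : finType) (P : pred I) (a b : I -> R) :
  (\sum_(i | P i) a i * b i) ^+ 2 <=
  (\sum_(i | P i) a i ^+ 2) * (\sum_(i | P i) b i ^+ 2).
Proof.
rewrite -subr_ge0.
suff -> : (\sum_(i | P i) a i ^+ 2) * (\sum_(i | P i) b i ^+ 2) -
    (\sum_(i | P i) a i * b i) ^+ 2 =
    2^-1 * \sum_(i | P i) \sum_(k | P k) (a i * b k - a k * b i) ^+ 2.
  by rewrite mulr_ge0 ?invr_ge0 ?ler0n //; do 2![apply: sumr_ge0 => ? _]; exact: sqr_ge0.
apply: (@mulfI _ 2); first by rewrite pnatr_eq0.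
rewrite mulrA mulfV ?pnatr_eq0 // mul1r.
have -> : \sum_(i | P i) \sum_(k | P k) (a i * b k - a k * b i) ^+ 2 =
   \sum_(i | P i) \sum_(k | P k) (a i ^+ 2 * b k ^+ 2)
   + \sum_(i | P i) \sum_(k | P k) (b i ^+ 2 * a k ^+ 2)
   - 2 * \sum_(i | P i) \sum_(k | P k) ((a i * b i) * (a k * b k)).
  rewrite -big_split mulr_sumr -sumrB; apply: eq_bigr => i _ /=.
  rewrite -big_split mulr_sumr -sumrB; apply: eq_bigr => k _ /=; ring.
do 3!rewrite -big_distrlr /=; ring.
Qed.

Lemma big_setX_pair (A : Type) (idx : A) (op : Monoid.com_law idx) (I K : finType)
    (X : {set I}) (Y : {set K}) (f : I * K -> A) :
  \big[op/idx]_(p in setX X Y) f p = \big[op/idx]_(x in X) \big[op/idx]_(y in Y) f (x, y).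
Proof.
rewrite pair_big /=; apply: eq_big => [[x y]|[x y] _] //=.
by rewrite in_setX.
Qed.

(** Quadruples are counted through equal differences: these are the normals of the hyperplanes, and
    the fourth moment expands in this form. *)
Definition additive_energy (F : finFieldType) (d : nat) (E : {set 'rV[F]_d}) : nat :=
  (\sum_(p in setX E E) \sum_(p' in setX E E) (p.1 - p.2 == p'.1 - p'.2)%R)%N.

Section Energy.
Variables (R : realType) (F : finFieldType) (chi : F -> R[i]).
Hypothesis F_odd : odd #|F|.
Hypothesis chi_nontrivial : nontrivial_additive_character chi.
Variables (h : nat) (j : F) (E : {set 'rV[F]_(h.*2)}).
Hypothesis j_neq0 : j != 0.
Hypothesis E_sphere : {in E, forall x, sqnorm x = j}.
Let q : R := #|F|%:R.
Let s : R := #|E|%:R.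
Let L : R := (additive_energy E)%:R.
Let V := 'rV[F]_(h.*2).

(** With [m = p.1 - p.2], the argument vanishes exactly when [sqnorm (m + y) = sqnorm y]. *)
Let kernel (p : V * V) (y : V) : R :=
  balanced_delta R (dotp y (p.1 - p.2) + sqnorm (p.1 - p.2) / 2).

Lemma sum_pair_const (a : R) : \sum_(p in setX E E) a = s ^+ 2 * a.
Proof. by rewrite sumr_const cardsX -mulr_natl natrM expr2. Qed.

(** A difference [m = p.1 - p.2] and a point [y] of [E] determine the remaining point [m + y]; if it
    lies in [E], then [sqnorm (m + y) = sqnorm y] puts [y] on the hyperplane. Writing [q] times that
    indicator as [1 + kernel p y] produces the mean [s ^+ 3]. *)
Lemma energy_le_kernel :
  q * L <= s ^+ 3
    + \sum_(y in E) \sum_(p in setX E E | sqnorm (p.1 - p.2) != 0) kernel p y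
    + \sum_(p in setX E E | sqnorm (p.1 - p.2) == 0) \sum_(y in E) kernel p y.
Proof.
have LE : L <= \sum_(p in setX E E) \sum_(y in E)
    (dotp y (p.1 - p.2) + sqnorm (p.1 - p.2) / 2 == 0)%:R.
  rewrite /L /additive_energy natr_sum; apply: ler_sum => p _.
  rewrite natr_sum big_setX_pair /= exchange_big; apply: ler_sum => y yE /=.
  set m := p.1 - p.2.
  under eq_bigr do rewrite (eq_sym m) subr_eq.
  have [myE|myE] := boolP (m + y \in E); last first.
    rewrite big1 ?ler0n // => x xE; case: eqVneq => // xE'.
    by rewrite -xE' xE in myE.
  rewrite (bigD1 (m + y)) //= eqxx big1 ?addr0 => [|x /andP [_ /negPf ->] //].
  rewrite ler_nat lt0b.
  have := E_sphere myE; rewrite addrC sqnormD (E_sphere yE) => /eqP.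
  rewrite -subr_eq0 => /eqP e; apply/eqP; apply: (@mulfI _ 2); first exact: odd_card_two_neq0.
  rewrite mulr0 -[RHS]e mulrDr mulrCA mulfV ?odd_card_two_neq0 //; ring.
apply: le_trans (ler_wpM2l (ler0n _ _) LE) _; rewrite -/q.
have kE p y : q * (dotp y (p.1 - p.2) + sqnorm (p.1 - p.2) / 2 == 0)%:R = 1 + kernel p y.
  by rewrite /kernel /balanced_delta addrCA subrr addr0.
rewrite mulr_sumr; under eq_bigr do rewrite mulr_sumr.
under eq_bigr => p _ do under eq_bigr do rewrite kE.
under eq_bigr do rewrite big_split /= sumr_const -/s.
rewrite big_split /= sum_pair_const -exprSr.
rewrite [X in _ + X](bigID (fun p => sqnorm (p.1 - p.2) != 0)) /= addrA.
rewrite [X in _ <= _ + X + _]exchange_big /=.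
by rewrite [X in _ <= _ + X](eq_bigl
  (fun p => (p \in setX E E) && ~~ (sqnorm (p.1 - p.2) != 0))) //
  => p; rewrite negbK.
Qed.

(** Cauchy-Schwarz over [y] in [E]; by positivity [y] may then run over the whole sphere, and the
    square expands into correlations with [tau = j]. Their main term needs [m' = l *: m] and
    [sqnorm m' = l * sqnorm m]; since also [sqnorm m' = l ^+ 2 * sqnorm m], this forces [l = 1], and
    such pairs are counted by [L]. *)
Lemma kernel_nonisotropic :
  (\sum_(y in E) \sum_(p in setX E E | sqnorm (p.1 - p.2) != 0) kernel p y) ^+ 2
  <= s * (q ^+ (h.*2) * L + 5 * q ^+ h.+1 * s ^+ 4).
Proof.
pose g y := \sum_(p in setX E E | sqnorm (p.1 - p.2) != 0) kernel p y.
have CS : (\sum_(y in E) g y) ^+ 2 <= s * \sum_(y in E) g y ^+ 2.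
  have := sum_mul_sqr_le (mem E) (fun=> 1) g.
  under eq_bigr do rewrite mul1r.
  by under [X in _ <= X * _]eq_bigr do rewrite expr1n; rewrite sumr_const.
apply: le_trans CS _; rewrite ler_wpM2l ?ler0n //.
apply: le_trans (_ : \sum_(y : V | sqnorm y == j) g y ^+ 2 <= _).
  rewrite [X in _ <= X](bigID (mem E)) /= -[X in X <= _]addr0; apply: lerD.
    rewrite le_eqVlt; apply/orP; left; apply/eqP; apply: eq_bigl => y.
    by case: (boolP (y \in E)) => yE; rewrite ?andbF // (E_sphere yE) eqxx.
  by apply: sumr_ge0 => y _; exact: sqr_ge0.
have -> : \sum_(y : V | sqnorm y == j) g y ^+ 2 =
    \sum_(p in setX E E | sqnorm (p.1 - p.2) != 0)
    \sum_(p' in setX E E | sqnorm (p'.1 - p'.2) != 0)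
    \sum_(y : V | sqnorm y == j) kernel p y * kernel p' y.
  rewrite (eq_bigr _ (fun y _ => expr2 (g y))).
  under eq_bigr do rewrite /g big_distrlr /=.
  by rewrite exchange_big; apply: eq_bigr => p _; rewrite exchange_big.
apply: le_trans (_ : \sum_(p in setX E E | sqnorm (p.1 - p.2) != 0)
    \sum_(p' in setX E E | sqnorm (p'.1 - p'.2) != 0)
    (q ^+ (h.*2) * (p.1 - p.2 == p'.1 - p'.2)%:R + 5 * q ^+ h.+1) <= _).
  apply: ler_sum => p /andP [_ p0]; apply: ler_sum => p' /andP [_ p'0].
  apply: le_trans (quadric_correlation_le F_odd chi_nontrivial _ _ _ _) _.
  - by apply: contraNneq p0 => ->; rewrite -dotpxx dotp0l.
  - by left.
  rewrite lerD2r ler_wpM2l ?exprn_ge0 ?ler0n // ler_nat.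
  case: existsP => // -[l /and3P [l0 /eqP mE /eqP]].
  rewrite mE sqnormZ mulrA => /(mulIf (invr_neq0 (odd_card_two_neq0 F_odd))).
  by move=> /(mulIf p0); rewrite expr2 -[RHS]mulr1 => /(mulfI l0) ->; rewrite scale1r eqxx.
apply: le_trans (_ : \sum_(p in setX E E) \sum_(p' in setX E E)
    (q ^+ (h.*2) * (p.1 - p.2 == p'.1 - p'.2)%:R + 5 * q ^+ h.+1) <= _).
  have pos p p' : 0 <= q ^+ (h.*2) * (p == p' :> V)%:R + 5 * q ^+ h.+1.
    by rewrite addr_ge0 ?mulr_ge0 ?exprn_ge0 ?ler0n.
  rewrite [X in _ <= X](bigID (fun p => sqnorm (p.1 - p.2) != 0)) /= -[X in X <= _]addr0.
  apply: lerD; last by do 2![apply: sumr_ge0 => ? _].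
  apply: ler_sum => p _.
  rewrite [X in _ <= X](bigID (fun p => sqnorm (p.1 - p.2) != 0)) /= -[X in X <= _]addr0.
  by apply: lerD => //; apply: sumr_ge0 => ? _.
under eq_bigr do rewrite big_split /= sum_pair_const -mulr_sumr -natr_sum.
rewrite big_split /= -mulr_sumr -natr_sum sum_pair_const -/L.
by rewrite lerD2l le_eqVlt; apply/orP; left; apply/eqP; ring.
Qed.

(** Pairs are grouped by their difference [m]. Cauchy-Schwarz over isotropic [m] gives a factor at
    most [L], the sum of [r m ^+ 2], and correlations along the cone [tau = 0] of the hyperplanes
    orthogonal to [y] and [y']. Proportional points of the sphere are equal or opposite, whence the
    factor 2. *)
Lemma kernel_isotropic :
  (\sum_(p in setX E E | sqnorm (p.1 - p.2) == 0) \sum_(y in E) kernel p y) ^+ 2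
  <= L * (2 * s * q ^+ (h.*2) + 5 * q ^+ h.+1 * s ^+ 2).
Proof.
pose r (m : V) : R := \sum_(p in setX E E | p.1 - p.2 == m) 1.
pose g (m : V) : R := \sum_(y in E) balanced_delta R (dotp m y + 0).
have -> : \sum_(p in setX E E | sqnorm (p.1 - p.2) == 0) \sum_(y in E) kernel p y
    = \sum_(m | sqnorm m == 0) r m * g m.
  rewrite (partition_big (fun p => p.1 - p.2) (fun m => sqnorm m == 0)) /=; last first.
    by move=> p /andP [].
  apply: eq_bigr => m m0; rewrite /r mulr_suml; apply: eq_big => [p|p /andP [_ /eqP pm]].
    by case: (eqVneq (p.1 - p.2) m) => [->|]; rewrite ?m0 ?andbT ?andbF.
  rewrite mul1r; apply: eq_bigr => y _.
  by rewrite /kernel pm (eqP m0) mul0r dotpC.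
apply: le_trans (sum_mul_sqr_le _ _ _) _.
apply: ler_pM; [by apply: sumr_ge0 => *; exact: sqr_ge0
  | by apply: sumr_ge0 => *; exact: sqr_ge0 | |].
  apply: le_trans (_ : \sum_m r m ^+ 2 <= _).
    rewrite [X in _ <= X](bigID (fun m => sqnorm m == 0)) /= lerDl.
    by apply: sumr_ge0 => *; exact: sqr_ge0.
  rewrite le_eqVlt; apply/orP; left; apply/eqP.
  rewrite /L /additive_energy natr_sum (partition_big (fun p => p.1 - p.2) predT) //=.
  apply: eq_bigr => m _; rewrite expr2 {1}/r mulr_suml.
  apply: eq_bigr => p /andP [_ /eqP ->]; rewrite mul1r natr_sum /r.
  rewrite [LHS]big_mkcondr /=; apply: eq_bigr => p' _.
  by rewrite eq_sym; case: ifP.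
have -> : \sum_(m | sqnorm m == 0) g m ^+ 2 = \sum_(y in E) \sum_(y' in E)
    \sum_(m : V | sqnorm m == 0) balanced_delta R (dotp m y + 0) * balanced_delta R (dotp m y' + 0).
  rewrite (eq_bigr _ (fun m _ => expr2 (g m))).
  under eq_bigr do rewrite /g big_distrlr /=.
  by rewrite exchange_big; apply: eq_bigr => p _; rewrite exchange_big.
apply: le_trans (_ : \sum_(y in E) \sum_(y' in E)
    (q ^+ (h.*2) * (y' \in [set y; - y])%:R + 5 * q ^+ h.+1) <= _).
  apply: ler_sum => y yE; apply: ler_sum => y' y'E.
  apply: le_trans (quadric_correlation_le F_odd chi_nontrivial _ _ _ _) _.
  - by apply: contraNneq j_neq0 => y0; rewrite -(E_sphere yE) y0 -dotpxx dotp0l.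
  - by right; rewrite E_sphere.
  rewrite lerD2r ler_wpM2l ?exprn_ge0 ?ler0n // ler_nat.
  case: existsP => // -[l /and3P [_ /eqP y'l _]].
  have := E_sphere y'E; rewrite y'l sqnormZ (E_sphere yE) -[RHS]mul1r.
  move=> /(mulIf j_neq0) /eqP; rewrite -[1](expr1n _ 2) eqf_sqr => /orP [] /eqP ->.
    by rewrite scale1r !inE eqxx.
  by rewrite scaleN1r !inE eqxx orbT.
under eq_bigr do rewrite big_split /= sumr_const -mulr_sumr -natr_sum -/s.
rewrite big_split /= -mulr_sumr -natr_sum sumr_const.
apply: lerD.
  rewrite mulrC ler_wpM2r ?exprn_ge0 ?ler0n // -natrM ler_nat mulnC -sum_nat_const.
  apply: leq_sum => y _.
  apply: leq_trans (_ : \sum_(y' in [set y; - y]) 1 <= 2)%N.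
    rewrite [X in (_ <= X)%N]big_mkcond [X in (X <= _)%N]big_mkcond leq_sum // => y' _.
    by do 2!case: (_ \in _).
  by rewrite sum1_card cards2; case: (_ != _).
by rewrite -mulrnA -[5 * q ^+ h.+1 *+ _]mulr_natr natrM -/s -expr2.
Qed.

(** One of the three summands of [energy_le_kernel] is at least a third of [q * L]. Squaring costs
    9, and keeping the larger of the two terms of its bound costs 2: hence [36 = 9 * 2 * 2] and
    [90 = 9 * 2 * 5]. *)
Lemma energy_bound :
  [\/ q * L <= 3 * s ^+ 3,
      q ^+ 2 * L <= 36 * s * q ^+ (h.*2),
      q ^+ 2 * L ^+ 2 <= 90 * q ^+ h.+1 * s ^+ 5 |
      q ^+ 2 * L <= 90 * q ^+ h.+1 * s ^+ 2].
Proof.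
move: energy_le_kernel kernel_nonisotropic kernel_isotropic.
set A1 := \sum_(y in E) _; set A2 := \sum_(p in _ | _) _.
have L0 : 0 <= L by exact: ler0n.
have s0 : 0 <= s by exact: ler0n.
have q0 : 0 <= q by exact: ler0n.
have sqr_le (a b : R) : 0 <= b -> b <= a -> b ^+ 2 <= a ^+ 2.
  by move=> b0 ba; rewrite ler_sqr ?nnegrE // (le_trans b0).
move=> H H1 H2.
have [H0|H0] := leP (q * L) (3 * s ^+ 3); first by constructor 1.
(* The failure of the first alternative makes [L] positive, so that it can be cancelled below. *)
have Lpos : 0 < L.
  rewrite lt_neqAle L0 andbT; apply: contraTneq H0 => <-.
  by rewrite mulr0 -leNgt mulr_ge0 ?exprn_ge0.
have [H3|H3] := leP (q * L) (3 * A1).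
  have H4 : (q * L) ^+ 2 <= 9 * (s * (q ^+ (h.*2) * L + 5 * q ^+ h.+1 * s ^+ 4)).
    apply: le_trans (sqr_le _ _ _ H3) _; first exact: mulr_ge0.
    rewrite exprMn; lra.
  have [H5|H5] := leP ((q * L) ^+ 2) (18 * s * q ^+ (h.*2) * L).
    constructor 2; rewrite -(ler_pM2r Lpos).
    have P0 : 0 <= s * q ^+ (h.*2) * L by rewrite !mulr_ge0 ?exprn_ge0.
    move: H5 P0; rewrite exprMn [L ^+ 2]expr2 -!mulrA.
    by move: (_ * (L * L)) (s * (_ * L)) => X Y ? ?; lra.
  constructor 3; rewrite -exprMn.
  have -> : 90 * q ^+ h.+1 * s ^+ 5 = 18 * (s * (5 * q ^+ h.+1 * s ^+ 4)).
    by rewrite (exprS s 4); ring.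
  move: H4 H5; rewrite mulrDr -!mulrA; lra.
have {}H3 : q * L <= 3 * A2 by lra.
have H4 : (q * L) ^+ 2 <= 9 * (L * (2 * s * q ^+ (h.*2) + 5 * q ^+ h.+1 * s ^+ 2)).
  apply: le_trans (sqr_le _ _ _ H3) _; first exact: mulr_ge0.
  rewrite exprMn; lra.
have H5 : q ^+ 2 * L <= 9 * (2 * s * q ^+ (h.*2) + 5 * q ^+ h.+1 * s ^+ 2).
  rewrite -(ler_pM2l Lpos); apply: le_trans (le_trans _ H4) _.
    by rewrite le_eqVlt; apply/orP; left; apply/eqP; ring.
  by rewrite le_eqVlt; apply/orP; left; apply/eqP; ring.
have [H6|H6] := leP (q ^+ 2 * L) (36 * s * q ^+ (h.*2)); first by constructor 2.
constructor 4; move: H5 H6; rewrite -!mulrA; lra.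
Qed.

End Energy.

(** * From the energy bound to the restricted estimate *)

(* With [l, S, Q] the logarithms of the energy, of the size of the set and of
   [q], each alternative is combined with [l <= 3 * S] (or with
   [S <= (d - 1) * Q + c2]) with the weights that give the coefficient
   [9 * d - 12] of [S]. *)
Lemma log_energy_le (R : realFieldType) (d l S Q c c2 : R) :
  d = 4 \/ 6 <= d -> 0 <= c -> 0 <= c2 -> 0 <= Q -> l <= 3 * S ->
  S <= (d - 1) * Q + c2 ->
  [\/ Q + l <= c + 3 * S, 2 * Q + l <= c + S + d * Q,
      2 * Q + 2 * l <= c + (d / 2 + 1) * Q + 5 * S |
      2 * Q + l <= c + (d / 2 + 1) * Q + 2 * S] ->
  (3 * d - 2) * l <= (3 * d - 2) * (c + c2) + (3 * d - 4) * (Q + 3 * S).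
Proof.
move=> d46 c0 c20 Q0 l3 Sle; have d4 : 4 <= d by case: d46 => ?; lra.
have dc : 0 <= (d - 4) * c by rewrite mulr_ge0 // subr_ge0.
have dc2 : 0 <= (d - 4) * c2 by rewrite mulr_ge0 // subr_ge0.
have dl : 0 <= (d - 4) * (3 * S - l) by rewrite mulr_ge0 // subr_ge0.
case=> H.
- have := mulr_ge0 (_ : 0 <= 3 * d - 2) (_ : 0 <= c + 3 * S - (Q + l)).
  by move=> /(_ ltac:(lra) ltac:(lra)); lra.
- lra.
(* With weight 6 here, [3 * d - 14] remains for [l <= 3 * S]. This is negative at [d = 4], where
   weight 5 and one copy of [S <= 3 * Q + c2] suffice. *)
- case: d46 => [E|d6]; first by subst d; lra.
  by have := mulr_ge0 (_ : 0 <= d - 6) (_ : 0 <= 3 * S - l); move=> /(_ ltac:(lra) ltac:(lra)); lra.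
- lra.
Qed.

(** In logarithms everything is linear: [c = ln 90] dominates the constants of the four
    alternatives, and [c2 = ln 2] comes from the size of the sphere. *)
Lemma energy_ratio_le (R : realType) (h : nat) (q N s L : R) :
  (2 <= h)%N -> 1 <= q -> 1 <= s -> s <= N -> 0 < L -> L <= s ^+ 3 ->
  q ^+ h.*2 <= 2 * (q * N) -> q * N <= 2 * q ^+ h.*2 ->
  [\/ q * L <= 3 * s ^+ 3,
      q ^+ 2 * L <= 36 * s * q ^+ (h.*2),
      q ^+ 2 * L ^+ 2 <= 90 * q ^+ h.+1 * s ^+ 5 |
      q ^+ 2 * L <= 90 * q ^+ h.+1 * s ^+ 2] ->
  q ^+ h.*2 / N ^+ 4 * L <=
    2880 * (s / N) `^ ((9 * (h.*2)%:R - 12) / (3 * (h.*2)%:R - 2)).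
Proof.
move=> h2 q1 s1 sN L0 Ls Nge Nle H.
have q0 : 0 < q by lra.
have s0 : 0 < s by lra.
have N0 : 0 < N by lra.
set d : R := (h.*2)%:R.
have lnd (x : R) (n : nat) : 0 < x -> ln (x ^+ n) = n%:R * ln x.
  by move=> x0; rewrite lnXn // mulr_natl.
have lnMp (x y : R) : 0 < x -> 0 < y -> ln (x * y) = ln x + ln y.
  by move=> x0 y0; rewrite lnM ?posrE.
have lnle (x y : R) : 0 < x -> x <= y -> ln x <= ln y.
  by move=> x0 xy; rewrite ler_ln ?posrE // (lt_le_trans x0).
have dE : d = 4 \/ 6 <= d.
  case: (ltnP h 3) => h3; last by right; rewrite ler_nat (leq_double 3).
  by left; rewrite /d (_ : h = 2%N) //; apply/eqP; rewrite eqn_leq -ltnS h3.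
have d4 : 4 <= d by case: dE => ?; lra.
have hE : h%:R = d / 2 :> R by rewrite /d -muln2 natrM mulfK ?pnatr_eq0.
have ln90 : 0 <= ln (90 : R) by rewrite ln_ge0 // ler1n.
have ln2 : 0 <= ln (2 : R) by rewrite ln_ge0 // ler1n.
have Q0 : 0 <= ln q by rewrite ln_ge0.
have Xp (x : R) n : 0 < x -> 0 < x ^+ n by exact: exprn_gt0.
have N1 : d * ln q <= ln 2 + (ln q + ln N).
  by rewrite -!lnMp -?lnd ?mulr_gt0 // lnle ?Xp.
have N2 : ln q + ln N <= ln 2 + d * ln q.
  by rewrite -!lnMp -?lnd -?lnMp ?mulr_gt0 ?Xp // lnle ?Xp ?mulr_gt0.
have main : (3 * d - 2) * ln L <= (3 * d - 2) * (ln 90 + ln 2) + (3 * d - 4) * (ln q + 3 * ln s).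
  apply: log_energy_le => //.
  - by rewrite -lnd // lnle.
  - have := lnle _ _ s0 sN; lra.
  have c3 : ln 3 <= ln (90 : R) by rewrite lnle ?ler_nat.
  have c36 : ln 36 <= ln (90 : R) by rewrite lnle ?ler_nat.
  have hS : h.+1%:R = d / 2 + 1 :> R by rewrite -natr1 hE.
  case: H => H; [constructor 1|constructor 2|constructor 3|constructor 4];
  have {H} := lnle _ _ _ H; rewrite !lnMp ?lnd ?mulr_gt0 ?Xp ?hS -/d // => /(_ isT); lra.
(* [2880 = 90 * 2 ^ 5]: one factor 2 is for [c2], the others cover the comparison of [q * N] with
   [q ^ d]. *)
have [K0 lnK] : 0 < (2880 : R) /\ ln (2880 : R) = ln 90 + 5 * ln 2.
  by rewrite ltr0n -lnd // -lnMp ?Xp // -natrX -natrM.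
move: (2880 : R) K0 lnK => K K0 lnK.
have Nz : N ^+ 4 != 0 by rewrite expf_neq0 // gt_eqF.
have D0 : 0 < 3 * d - 2 by lra.
rewrite -ler_ln ?posrE ?mulr_gt0 ?invr_gt0 ?powR_gt0 ?divr_gt0 ?Xp //.
rewrite !lnMp ?mulr_gt0 ?invr_gt0 ?powR_gt0 ?divr_gt0 ?Xp //.
rewrite ln_powR lnMp ?invr_gt0 ?Xp // !lnV ?posrE ?Xp // !lnd //.
rewrite lnK -(ler_pM2l D0) [X in _ <= X]mulrDr.
rewrite [X in _ <= _ + X](_ : _ = (9 * d - 12) * (ln s - ln N)); last first.
  by rewrite mulrA mulrCA mulfV ?mulr1 // gt_eqF.
rewrite -/d.
(* The powers of [q] balance exactly against [N]: [(3 * d - 2) * d + (3 * d - 4) = (3 * d + 4) * (d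
   - 1)]. *)
have P1 : 0 <= (3 * d + 4) * (ln 2 + (ln q + ln N) - d * ln q).
  by rewrite mulr_ge0 // ?subr_ge0 //; lra.
have P2 : 0 <= (d - 4) * ln 2 by rewrite mulr_ge0 // subr_ge0.
lra.
Qed.

Lemma additive_energy_le_cube (F : finFieldType) (d : nat) (E : {set 'rV[F]_d}) :
  (additive_energy E <= #|E| ^ 3)%N.
Proof.
have -> : (#|E| ^ 3 = #|setX E E| * #|E|)%N by rewrite cardsX mulnn -expnSr.
rewrite /additive_energy -sum_nat_const; apply: leq_sum => p _.
rewrite big_setX_pair exchange_big /=.
rewrite -sum1_card; apply: leq_sum => z zE.
under eq_bigr do rewrite eq_sym subr_eq.
rewrite big_mkcond (bigD1 (p.1 - p.2 + z)) //= big1 ?addn0 => [|x /negPf ->]; last by case: ifP.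
by rewrite eqxx; case: ifP.
Qed.

Section RestrictedEnergy.
Variables (R : realType) (F : finFieldType) (chi : F -> R[i]).
Hypothesis F_odd : odd #|F|.
Hypothesis chi_nontrivial : nontrivial_additive_character chi.
Variables (h : nat) (j : F).
Hypothesis h_ge2 : (2 <= h)%N.
Hypothesis j_neq0 : j != 0.
Let q : R := #|F|%:R.
Let N : R := #|sphere h.*2 j|%:R.

Lemma card_sphere_ge_half : q ^+ h.*2 <= 2 * (q * N) /\ q * N <= 2 * q ^+ h.*2.
Proof.
have := card_sphere_approx F_odd chi_nontrivial h j_neq0; rewrite -/q -/N ler_norml.
have q3 : 3 <= q.
  rewrite ler_nat; have : (1 < #|F|)%N by exact: card_finNzRing_gt1.
  by move: F_odd; case: #|F| => [|[|[|n]]].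
have : 2 * q ^+ h <= q ^+ h.*2.
  rewrite -addnn exprD ler_wpM2r ?exprn_ge0 ?ler0n //.
  apply: le_trans (_ : q ^+ 1 <= _); first by rewrite expr1; lra.
  by rewrite ler_eXn2l ?(ltnW h_ge2) //; lra.
move: (q ^+ _) (q ^+ _) => a b H /andP [H1 H2]; split; lra.
Qed.

(** The left side is the fourth power of the [L^4] norm of the extension of the indicator of [E]. *)
Lemma restricted_energy (E : {set 'rV[F]_h.*2}) : E \subset sphere h.*2 j ->
  q ^+ h.*2 / N ^+ 4 * (additive_energy E)%:R <=
    2880 * (#|E|%:R / N) `^ ((9 * (h.*2)%:R - 12) / (3 * (h.*2)%:R - 2)).
Proof.
move=> ES; have [L0|L0] := posnP (additive_energy E).
  by rewrite L0 mulr0 (mulr_ge0 (ler0n _ _) (powR_ge0 _ _)).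
have [N1 N2] := card_sphere_ge_half.
have E0 : (0 < #|E|)%N.
  have := leq_trans L0 (additive_energy_le_cube E).
  by rewrite expn_gt0 orbF.
apply: energy_ratio_le => //.
- by rewrite ler1n; apply/card_gt0P; exists 0.
- by rewrite ler1n.
- by rewrite ler_nat; exact: subset_leq_card.
- by rewrite ltr0n.
- by rewrite -natrX ler_nat; exact: additive_energy_le_cube.
apply: (energy_bound F_odd chi_nontrivial j_neq0) => x xE.
by have := subsetP ES _ xE; rewrite inE => /eqP.
Qed.

End RestrictedEnergy.

Lemma normc_complex (R : realType) (z : R[i]) : (Normc.normc z)%:C%C = `|z|.
Proof. by []. Qed.

Lemma normc_ge0 (R : realType) (z : R[i]) : 0 <= Normc.normc z.
Proof. by case: z => a b /=; exact: sqrtr_ge0. Qed.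

Lemma normc_real (R : realType) (a : R) : 0 <= a -> Normc.normc a%:C%C = a.
Proof. by move=> a0 /=; rewrite expr0n /= addr0 sqrtr_sqr ger0_norm. Qed.

Lemma normc_sum (R : realType) (I : Type) (r : seq I) (P : pred I) (z : I -> R[i]) :
  Normc.normc (\sum_(i <- r | P i) z i) <= \sum_(i <- r | P i) Normc.normc (z i).
Proof.
apply: (big_ind2 (fun (x : R[i]) y => Normc.normc x <= y)) => //.
  by rewrite Normc.normc0.
by move=> x a y b xa yb; apply: le_trans (le_normcD _ _) _; exact: lerD.
Qed.

(** * Fourth moments of exponential sums *)

Section FourthMoment.
Variables (R : realType) (F : finFieldType) (chi : F -> R[i]).
Hypothesis chi_nontrivial : nontrivial_additive_character chi.

(** [#|F|] annihilates [v], so [chi v] is a root of unity; its inverse is therefore its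
    conjugate. *)
Lemma charN v : chi (- v) = (chi v)^*.
Proof.
have chi1 : chi v * chi (- v) = 1.
  by rewrite -(charD chi_nontrivial) subrr (char0 chi_nontrivial).
have chin n : chi (v *+ n) = chi v ^+ n.
  elim: n => [|n IH]; first by rewrite mulr0n (char0 chi_nontrivial).
  by rewrite mulrS (charD chi_nontrivial) IH exprS.
have normchi : `|chi v| = 1.
  have := chin #|F|; rewrite -mulr_natr natr_card_eq0 mulr0 (char0 chi_nontrivial).
  move=> /(congr1 (fun z => `|z|)) /esym /eqP; rewrite normr1 normrX pexpr_eq1 //.
    by move/eqP.
  by apply/card_gt0P; exists 0.
have chi0 : chi v != 0 by rewrite -normr_eq0 normchi oner_eq0.
by apply: (mulfI chi0); rewrite chi1 -normCK normchi expr1n.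
Qed.

Variable d : nat.
Let V := 'rV[F]_d.

Definition char_transform (f : V -> R[i]) (m : V) : R[i] :=
  \sum_x chi (- dotp x m) * f x.

Lemma fourth_moment_char_transform (f : V -> R[i]) :
  (\sum_m `|char_transform f m| ^+ 4 : R[i]) = #|F|%:R ^+ d *
  \sum_(p : V * V) \sum_(p' : V * V) (p.1 - p.2 == p'.1 - p'.2)%:R *
    ((f p.1 * (f p.2)^*) * (f p'.1 * (f p'.2)^*)^*).
Proof.
have sq m : `|char_transform f m| ^+ 2 =
    \sum_(p : V * V) chi (- dotp (p.1 - p.2) m) * (f p.1 * (f p.2)^*).
  rewrite normCK /char_transform rmorph_sum big_distrlr /= pair_big /=.
  apply: eq_bigr => p _; rewrite rmorphM /= -charN mulrACA -(charD chi_nontrivial).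
  by rewrite dotpDl dotpNl; congr (chi _ * _); ring.
have fourth m : `|char_transform f m| ^+ 4 = \sum_(p : V * V) \sum_(p' : V * V)
    chi (dotp m (p'.1 - p'.2 - (p.1 - p.2))) * ((f p.1 * (f p.2)^*) * (f p'.1 * (f p'.2)^*)^*).
  (* The second factor is real; conjugating it makes the two phases subtract, so that orthogonality
     in [m] yields equal differences. *)
  have -> : `|char_transform f m| ^+ 4 =
      `|char_transform f m| ^+ 2 * (`|char_transform f m| ^+ 2)^*.
    by rewrite rmorphXn /= conj_normC -exprD.
  rewrite sq rmorph_sum big_distrlr /=.
  apply: eq_bigr => p _; apply: eq_bigr => p' _.
  rewrite rmorphM /= -charN mulrACA -(charD chi_nontrivial) opprK.
  by congr (chi _ * _); rewrite !(dotpC m) !dotpDl !dotpNl !dotpDl !dotpNl; ring.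
under eq_bigr do rewrite fourth.
rewrite exchange_big mulr_sumr; apply: eq_bigr => p _ /=.
rewrite exchange_big mulr_sumr; apply: eq_bigr => p' _ /=.
by rewrite -mulr_suml (sum_char_dotp chi_nontrivial) subr_eq0 eq_sym -mulrA.
Qed.

(** The coefficients in the expansion of the fourth moment are nonnegative, so [f] may be replaced
    by [a] times the indicator of [E]. *)
Lemma fourth_moment_le_energy (f : V -> R[i]) (E : {set V}) (a : R) :
  0 <= a -> (forall x, Normc.normc (f x) <= a * (x \in E)%:R) ->
  \sum_m Normc.normc (char_transform f m) ^+ 4
    <= #|F|%:R ^+ d * a ^+ 4 * (additive_energy E)%:R.
Proof.
move=> a0 fa; rewrite -lecR.
have -> : (\sum_m Normc.normc (char_transform f m) ^+ 4)%:C%C =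
    \sum_m `|char_transform f m| ^+ 4.
  by rewrite rmorph_sum; apply: eq_bigr => m _; rewrite rmorphXn.
have pos : 0 <= \sum_m `|char_transform f m| ^+ 4 by apply: sumr_ge0 => m _; exact: exprn_ge0.
rewrite -(ger0_norm pos) fourth_moment_char_transform normrM normrX normr_nat.
rewrite -mulrA rmorphM rmorphXn /= rmorph_nat ler_wpM2l ?exprn_ge0 ?ler0n //.
pose w (p : V * V) : R := a ^+ 2 * (p \in setX E E)%:R.
have wp p : Normc.normc (f p.1 * (f p.2)^*) <= w p.
  have -> : Normc.normc (f p.1 * (f p.2)^*) = Normc.normc (f p.1) * Normc.normc (f p.2).
    by rewrite Normc.normcM; congr (_ * _); apply: complexI; rewrite !normc_complex norm_conjC.
  rewrite /w [p in p \in _]surjective_pairing in_setX -mulnb natrM expr2 mulrACA.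
  by apply: ler_pM => //; exact: normc_ge0.
apply: le_trans (_ : (\sum_(p : V * V) \sum_(p' : V * V)
    (p.1 - p.2 == p'.1 - p'.2)%:R * (w p * w p'))%:C%C <= _).
  apply: le_trans (ler_norm_sum _ _ _) _; rewrite rmorph_sum; apply: ler_sum => p _ /=.
  apply: le_trans (ler_norm_sum _ _ _) _; rewrite rmorph_sum; apply: ler_sum => p' _ /=.
  rewrite normrM normr_nat [X in _ <= X]rmorphM /= rmorph_nat ler_wpM2l ?ler0n //.
  rewrite normrM norm_conjC [X in _ <= X]rmorphM /= -!normc_complex.
  rewrite ler_pM ?ler0c ?normc_ge0 // lecR.
    exact: wp.
  exact: wp.
rewrite lecR /additive_energy le_eqVlt; apply/orP; left; apply/eqP.
rewrite natr_sum mulr_sumr [RHS]big_mkcond; apply: eq_bigr => p _ /=.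
rewrite /w; case: (p \in _); last by rewrite big1 // => p' _; rewrite mulr0 mul0r mulr0.
rewrite natr_sum mulr_sumr [RHS]big_mkcond; apply: eq_bigr => p' _ /=.
case: (p' \in _); last by rewrite !mulr0.
by rewrite !mulr1 -exprD mulrC.
Qed.

End FourthMoment.

(** * Dyadic decomposition *)

Lemma sum_pow4_le (R : realFieldType) (n : nat) (a : 'I_n -> R) :
  (\sum_k a k) ^+ 4 <= n%:R ^+ 3 * \sum_k a k ^+ 4.
Proof.
have sq (b : 'I_n -> R) : (\sum_k b k) ^+ 2 <= n%:R * \sum_k b k ^+ 2.
  have := sum_mul_sqr_le predT (fun=> 1) b.
  under eq_bigr do rewrite mul1r.
  by under [X in _ <= X * _]eq_bigr do rewrite expr1n; rewrite sumr_const card_ord.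
have nn : 0 <= n%:R :> R by exact: ler0n.
have S2 : 0 <= \sum_k a k ^+ 2 by apply: sumr_ge0 => k _; exact: sqr_ge0.
rewrite (exprM _ 2 2); apply: le_trans (_ : (n%:R * \sum_k a k ^+ 2) ^+ 2 <= _).
  by rewrite ler_sqr ?nnegrE ?sqr_ge0 ?mulr_ge0.
rewrite exprMn (exprSr _ 2) -mulrA ler_wpM2l ?exprn_ge0 //.
apply: le_trans (sq _) _; rewrite ler_wpM2l // le_eqVlt; apply/orP; left; apply/eqP.
by apply: eq_bigr => k _; rewrite -exprM.
Qed.

Section Dyadic.
Variables (R : realType) (F : finFieldType) (chi : F -> R[i]).
Hypothesis F_odd : odd #|F|.
Hypothesis chi_nontrivial : nontrivial_additive_character chi.
Variables (h : nat) (j : F).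
Hypothesis h_ge2 : (2 <= h)%N.
Hypothesis j_neq0 : j != 0.
Let q : R := #|F|%:R.
Let N : R := #|sphere h.*2 j|%:R.
Let V := 'rV[F]_h.*2.
(** Four times the reciprocal of the endpoint exponent [(12 * d - 8) / (9 * d - 12)]. *)
Let kappa : R := (9 * (h.*2)%:R - 12) / (3 * (h.*2)%:R - 2).

Lemma card_sphere_ge1 : 1 <= N.
Proof.
have [H _] := card_sphere_ge_half F_odd chi_nontrivial h_ge2 j_neq0.
rewrite ler1n lt0n; apply/eqP => N0; move: H; rewrite N0 !mulr0 leNgt.
by rewrite exprn_gt0 // ltr0n; apply/card_gt0P; exists 0.
Qed.

Lemma card_sphere_le : N <= q ^+ h.*2.
Proof. by rewrite -natrX ler_nat (_ : _ ^ _ = #|{: V}|)%N ?max_card // card_mx mul1n. Qed.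

Lemma kappa_bounds : 0 <= kappa <= 4.
Proof.
have d4 : 4 <= (h.*2)%:R :> R by rewrite ler_nat (leq_double 2).
have D0 : 0 < 3 * (h.*2)%:R - 2 :> R by lra.
by rewrite /kappa ler_pdivlMr // ler_pdivrMr // mul0r; apply/andP; split; lra.
Qed.

(* Applied to singletons, the hypothesis on [B] gives [|f| <= N * B], so [N * B] serves as
   the top level. *)
Lemma dyadic_fourth_moment (f : V -> R[i]) (B : R) (K : nat) :
  (forall x, x \notin sphere h.*2 j -> f x = 0) ->
  (forall (E : {set V}) (a : R), 0 <= a -> E \subset sphere h.*2 j ->
     {in E, forall x, a <= Normc.normc (f x)} ->
     a * (#|E|%:R / N) `^ (kappa / 4) <= B) ->
  q ^+ h.*2 <= 2 ^+ K ->
  \sum_m Normc.normc (N^-1%:C%C * char_transform chi f m) ^+ 4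
    <= K.+1%:R ^+ 4 * (15 * B) ^+ 4.
Proof.
move=> f0 HB qK.
have N1 := card_sphere_ge1; have N0 : 0 < N by exact: lt_le_trans N1.
have /andP [k0 k4] := kappa_bounds.
have B0 : 0 <= B.
  have := HB set0 0 (lexx 0) (sub0set _) (fun x _ => normc_ge0 (f x)).
  by rewrite mul0r.
have fB x : Normc.normc (f x) <= N * B.
  have [xS|xS] := boolP (x \in sphere h.*2 j); last first.
    by rewrite f0 // Normc.normc0 mulr_ge0 // ltW.
  rewrite mulrC -ler_pdivrMr //.
  apply: le_trans (HB [set x] (Normc.normc (f x)) (normc_ge0 _) _ _); last first.
  - by move=> y /set1P ->.
  - by rewrite sub1set.
  rewrite cards1 mul1r ler_wpM2l ?normc_ge0 //.
  rewrite ger1_powR ?invr_gt0 ?N0 ?invf_le1 //.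
  by rewrite ler_pdivrMr // mul1r.
have pow2 k : 0 < (2 : R) ^+ k by rewrite exprn_gt0.
(* [level x] is the first [k < K] with [|f x| > N * B / 2 ^ (k + 1)]. The default value [K] of
   [find] collects the points with [|f x| <= N * B / 2 ^ K]. *)
pose big (x : V) k := N * B < Normc.normc (f x) * 2 ^+ k.+1.
pose level (x : V) := find (big x) (iota 0 K).
have level_lt x : (level x < K.+1)%N.
  by rewrite ltnS -[X in (_ <= X)%N](size_iota 0 K) find_size.
have level_le x : Normc.normc (f x) <= N * B / 2 ^+ level x.
  rewrite ler_pdivlMr //; case E : (level x) => [|k]; first by rewrite expr0 mulr1.
  have kK : (k < K)%N by rewrite -ltnS -E level_lt.
  have := @before_find _ 0%N (big x) (iota 0 K) k.
  by rewrite -/(level x) E ltnSn nth_iota // add0n => /(_ isT) /negbT; rewrite -leNgt.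
have level_gt x : (level x < K)%N -> N * B / 2 ^+ (level x).+1 <= Normc.normc (f x).
  move=> lK; rewrite ler_pdivrMr // ltW //.
  have : has (big x) (iota 0 K) by rewrite has_find size_iota.
  by move=> /(nth_find 0%N); rewrite -/(level x) nth_iota.
pose Ek (k : nat) := [set x in sphere h.*2 j | level x == k].
pose fk (k : nat) (x : V) := if level x == k then f x else 0.
have split m : char_transform chi f m = \sum_(k < K.+1) char_transform chi (fk k) m.
  rewrite exchange_big /=; apply: eq_bigr => x _; rewrite -mulr_sumr; congr (_ * _).
  rewrite (bigD1 (Ordinal (level_lt x))) //= /fk eqxx big1 ?addr0 // => k.
  by rewrite -val_eqE /= eq_sym => /negPf ->.
have EkS k : Ek k \subset sphere h.*2 j by apply/subsetP => x; rewrite inE => /andP [].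
have level_moment (k : 'I_K.+1) :
    \sum_m Normc.normc (N^-1%:C%C * char_transform chi (fk k) m) ^+ 4 <= 15 ^+ 4 * B ^+ 4.
  set a := N * B / 2 ^+ k.
  have a0 : 0 <= a by rewrite /a !mulr_ge0 ?invr_ge0 // ltW.
  have FM := fourth_moment_le_energy chi_nontrivial (E := Ek k) (f := fk k) a0.
  have {}FM : \sum_m Normc.normc (N^-1%:C%C * char_transform chi (fk k) m) ^+ 4
     <= a ^+ 4 * (q ^+ h.*2 / N ^+ 4 * (additive_energy (Ek k))%:R).
    under eq_bigr do rewrite Normc.normcM normc_real ?invr_ge0 ?(ltW N0) // exprMn.
    rewrite -mulr_sumr (_ : _ * (_ * _) =
      N^-1 ^+ 4 * (q ^+ h.*2 * a ^+ 4 * (additive_energy (Ek k))%:R)).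
      rewrite ler_wpM2l ?exprn_ge0 ?invr_ge0 ?(ltW N0) //; apply: FM => x.
      rewrite /fk inE; case: (eqVneq (level x) k) => [xk|]; rewrite ?andbT ?andbF.
        have [xS|xS] := boolP (x \in _); first by rewrite mulr1 /a -xk; exact: level_le.
        by rewrite f0 // Normc.normc0 mulr0.
      by rewrite Normc.normc0 mulr0.
    by rewrite exprVn; ring.
  apply: le_trans FM _.
  (* Below level [K], [|f| >= a / 2] on [Ek k], so the hypothesis on [B] applies. The halving costs
     [2 ^ 4], and [16 * 2880 <= 15 ^ 4]. *)
  have [kK|] := ltnP k K.
    have H1 : (a / 2) * (#|Ek k|%:R / N) `^ (kappa / 4) <= B.
      apply: HB => //; first by rewrite divr_ge0.
      move=> x; rewrite inE => /andP [_ /eqP xk].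
      by have := level_gt x; rewrite xk exprSr invfM mulrA => /(_ kK).
    have H2 : a ^+ 4 * (#|Ek k|%:R / N) `^ kappa <= 16 * B ^+ 4.
      have -> : (#|Ek k|%:R / N) `^ kappa = ((#|Ek k|%:R / N) `^ (kappa / 4)) ^+ 4.
        by rewrite -powR_mulrn ?powR_ge0 // -powRrM divfK.
      have H3 : 0 <= a / 2 * (#|Ek k|%:R / N) `^ (kappa / 4).
        apply: mulr_ge0; [exact: (divr_ge0 a0 (ler0n _ 2))|exact: powR_ge0].
      have := lerXn2r 4 H3 B0 H1; rewrite exprMn; move: (_ `^ _) => Y.
      by rewrite exprMn exprVn; set A := a ^+ 4; set Z := Y ^+ 4; lra.
    have RE := restricted_energy F_odd chi_nontrivial h_ge2 j_neq0 (EkS k).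
    apply: le_trans (ler_wpM2l (exprn_ge0 4 a0) RE) _.
    rewrite mulrCA; apply: le_trans (ler_wpM2l (ler0n _ _) H2) _.
    rewrite mulrA ler_wpM2r ?exprn_ge0 //; lra.
  (* Level [K] has no lower bound on [|f|], but [2 ^ K >= q ^ d >= N] makes the trivial energy bound
     [N ^ 3] sufficient. *)
  move=> Kk; have {Kk}kK : k = K :> nat by apply/eqP; rewrite eqn_leq Kk -ltnS ltn_ord.
  have EL : (additive_energy (Ek k))%:R <= N ^+ 3.
    rewrite -natrX ler_nat; apply: leq_trans (additive_energy_le_cube _) _.
    by rewrite leq_exp2r // subset_leq_card.
  have q0 : 0 <= q by exact: ler0n.
  apply: le_trans (_ : a ^+ 4 * (q ^+ h.*2 / N ^+ 4 * N ^+ 3) <= _).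
    by rewrite !ler_wpM2l ?exprn_ge0 ?mulr_ge0 ?exprn_ge0 ?invr_ge0 ?exprn_ge0 ?(ltW N0).
  have NK : N <= 2 ^+ K by exact: le_trans card_sphere_le _.
  rewrite /a kK.
  have -> : (N * B / 2 ^+ K) ^+ 4 * (q ^+ h.*2 / N ^+ 4 * N ^+ 3) =
     B ^+ 4 * (q ^+ h.*2 / 2 ^+ K * (N / 2 ^+ K) ^+ 3).
    by field; rewrite !gt_eqF.
  rewrite mulrC.
  apply: ler_pM; rewrite ?exprn_ge0 ?mulr_ge0 ?exprn_ge0 ?invr_ge0 ?divr_ge0 ?exprn_ge0
    ?(ltW N0) ?(ltW (pow2 _)) //.
  apply: le_trans (_ : 1 * 1 <= _); last by rewrite mul1r exprn_ege1 // ler1n.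
  apply: ler_pM; rewrite ?exprn_ge0 ?mulr_ge0 ?exprn_ge0 ?invr_ge0 ?divr_ge0 ?exprn_ge0
    ?(ltW N0) ?(ltW (pow2 _)) //.
    by rewrite ler_pdivrMr // mul1r.
  by rewrite exprn_ile1 ?divr_ge0 ?(ltW N0) ?(ltW (pow2 _)) // ler_pdivrMr // mul1r.
(* Separating the levels costs [(K + 1) ^ 3], and summing their [K + 1] moments gives the fourth
   power. *)
apply: le_trans (_ : \sum_m K.+1%:R ^+ 3 * \sum_(k < K.+1)
    Normc.normc (N^-1%:C%C * char_transform chi (fk k) m) ^+ 4 <= _).
  apply: ler_sum => m _; apply: le_trans (sum_pow4_le _).
  rewrite split mulr_sumr lerXn2r ?nnegrE ?normc_ge0 ?normc_sum //.
  by apply: sumr_ge0 => k _; exact: normc_ge0.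
rewrite -mulr_sumr exchange_big /=.
rewrite [X in _ <= X](_ : _ = K.+1%:R ^+ 3 * (K.+1%:R * (15 * B) ^+ 4)); last first.
  by rewrite exprSr -mulrA.
rewrite ler_wpM2l ?exprn_ge0 ?ler0n //.
apply: le_trans (ler_sum _ (fun k _ => level_moment k)) _.
by rewrite sumr_const card_ord exprMn mulr_natl.
Qed.

End Dyadic.

(** * Functions and norms on the sphere *)

Section SphereFunctions.
Variables (R : realType) (F : finFieldType) (d : nat) (j : F).
Let V := 'rV[F]_d.

Definition zero_extension (f : sphere_pt d j -> R[i]) (x : V) : R[i] :=
  oapp f 0 (insub x).

Lemma zero_extension_val (f : sphere_pt d j -> R[i]) u : zero_extension f (val u) = f u.
Proof. by rewrite /zero_extension valK. Qed.

Lemma zero_extension_out (f : sphere_pt d j -> R[i]) x :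
  x \notin sphere d j -> zero_extension f x = 0.
Proof. by move=> xS; rewrite /zero_extension insubN. Qed.

Lemma sum_sphere_pt (A : nmodType) (g : V -> A) :
  \sum_(u : sphere_pt d j) g (val u) = \sum_(x in sphere d j) g x.
Proof. by rewrite [RHS]big_sub. Qed.

Lemma extension_char_transform (chi : F -> R[i]) (f : sphere_pt d j -> R[i]) m :
  extension chi f m =
    (#|sphere d j|%:R^-1 : R)%:C%C * char_transform chi (zero_extension f) m.
Proof.
rewrite /extension fmorphV rmorph_nat; congr (_ * _).
under eq_bigr do rewrite -zero_extension_val.
rewrite (sum_sphere_pt (fun x => chi (- dotp x m) * zero_extension f x)).
rewrite /char_transform [RHS](bigID (mem (sphere d j))) /= [X in _ + X]big1 ?addr0 //.
by move=> x xS; rewrite zero_extension_out ?mulr0.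
Qed.

(** Chebyshev's inequality at the exponent [p], then a passage from [p] to [p0], possible because
    the density of [E] in the sphere is at most 1. For [p = +oo] the maximum dominates [a] once [E]
    has a point. Only through this bound does the [L^p] norm enter the main estimate. *)
Lemma Lnorm_surface_ge (f : sphere_pt d j -> R[i]) (p : \bar R) (p0 a : R)
    (E : {set V}) :
  0 < p0 -> (p0%:E <= p)%E -> 0 <= a -> E \subset sphere d j ->
  {in E, forall x, a <= Normc.normc (zero_extension f x)} ->
  a * (#|E|%:R / #|sphere d j|%:R) `^ p0^-1 <= Lnorm_surface p f.
Proof.
move=> p00 p0p a0 ES aE; rewrite /Lnorm_surface.
set N : R := #|sphere d j|%:R.
have pos_norm : 0 <= Lnorm_weighted N^-1 p f.
  case: p p0p => [r||] //= _; first exact: powR_ge0.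
  by elim/big_ind: _ => // [x y x0 y0|x _]; [rewrite le_max x0|exact: normc_ge0].
have [E0|[x0 x0E]] := set_0Vmem E.
  by rewrite E0 cards0 mul0r powR0 ?mulr0 // invr_neq0 // gt_eqF.
have E0 : (0 < #|E|)%N by apply/card_gt0P; exists x0.
have EN : (#|E| <= #|sphere d j|)%N by exact: subset_leq_card.
have N0 : 0 < N by rewrite ltr0n (leq_trans E0).
have t01 : 0 < #|E|%:R / N <= 1.
  apply/andP; split; [by apply: divr_gt0 => //; rewrite ltr0n|].
  by rewrite ler_pdivrMr // mul1r ler_nat.
set t := #|E|%:R / N in t01 *; have /andP [t0 t1] := t01.
case: p p0p pos_norm => [r||] //=.
- rewrite lee_fin => p0r _; have r0 : 0 < r by exact: lt_le_trans p0r.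
  apply: le_trans (_ : a * t `^ r^-1 <= _).
    by rewrite ler_wpM2l // ger_powR // lef_pV2 ?posrE.
  rewrite -{1}(powRr1 a0) -(mulfV (lt0r_neq0 r0)) powRrM -powRM ?powR_ge0 ?(ltW t0) //.
  rewrite ge0_ler_powR ?nnegrE ?invr_ge0 ?(ltW r0) //.
  + by rewrite mulr_ge0 ?powR_ge0 ?(ltW t0).
  + by rewrite mulr_ge0 ?invr_ge0 ?(ltW N0) // sumr_ge0 // => x _; exact: powR_ge0.
  rewrite /t mulrA mulrC ler_wpM2l ?invr_ge0 ?(ltW N0) //.
  under [X in _ <= X]eq_bigr do rewrite -zero_extension_val.
  rewrite (sum_sphere_pt (fun x => Normc.normc (zero_extension f x) `^ r)).
  rewrite (bigID (mem E)) /= -[X in X <= _]addr0; apply: lerD; last first.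
    by apply: sumr_ge0 => x _; exact: powR_ge0.
  rewrite mulr_natr -sumr_const [X in _ <= X](eq_bigl (mem E)) /=; last first.
    move=> x /=; case: (boolP (x \in E)) => xE; rewrite ?andbF // andbT.
    by rewrite (subsetP ES).
  by apply: ler_sum => x xE; rewrite ge0_ler_powR ?nnegrE ?(ltW r0) ?normc_ge0 // aE.
- move=> _ _; apply: le_trans (_ : a * 1 <= _).
    rewrite ler_wpM2l //; rewrite -[X in _ <= X](powRr0 t).
    by rewrite ger_powR // invr_ge0 ltW.
  rewrite mulr1; apply: le_trans (aE _ x0E) _.
  have x0S := subsetP ES _ x0E.
  rewrite -[x0](@SubK _ (mem (sphere d j)) (sphere_pt d j) _ x0S).
  by rewrite zero_extension_val (le_bigmax _ (fun u => Normc.normc (f u))).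
Qed.

End SphereFunctions.

(** * The number of levels and the extension estimate *)

(** The logarithm of [y = n ^ eps] is at most [y], so [ln n <= n ^ eps / eps]. The summand 2 pays
    for the rounding up and for the extra level. *)
Lemma up_log2_le (R : realType) (m n : nat) (eps : R) :
  (0 < n)%N -> 0 < eps ->
  (up_log 2 (n ^ m)).+1%:R <= (2 + m%:R / (eps * ln 2)) * n%:R `^ eps.
Proof.
move=> n0 eps0.
have ln20 : 0 < ln (2 : R) by rewrite ln_gt0 // ltr1n.
have n1 : 1 <= n%:R :> R by rewrite ler1n.
have P1 : 1 <= n%:R `^ eps by rewrite -[X in X <= _](powRr0 n%:R) ler_powR // ltW.
have c0 : 0 <= m%:R / (eps * ln 2) by rewrite divr_ge0 ?ler0n // mulr_ge0 // ltW.
have [nm1|nm1] := leqP (n ^ m) 1.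
  have -> : up_log 2 (n ^ m) = 0%N by apply/eqP; rewrite up_log_eq0 nm1 orbT.
  by apply: le_trans (_ : 2 * 1 <= _); [rewrite mulr1 ler1n|apply: ler_pM => //; lra].
have := up_log_gtn (isT : (1 < 2)%N) nm1; case E: (up_log _ _) => [|K] /=.
  by move: E => /eqP; rewrite up_log_eq0 /= leqNgt nm1.
move=> K2.
have : K%:R * ln 2 <= m%:R * ln n%:R :> R.
  rewrite !mulr_natl -!lnXn ?ltr0n // ler_ln ?posrE ?exprn_gt0 ?ltr0n //.
  by rewrite -!natrX ler_nat ltnW.
have : eps * ln n%:R <= n%:R `^ eps.
  by rewrite -ln_powR ltW // ln_sublinear // powR_gt0 // ltr0n.
set P := _ `^ _; set l := ln n%:R => l1 l2.
have : K%:R <= m%:R / (eps * ln 2) * P.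
  rewrite mulrAC ler_pdivlMr ?mulr_gt0 // mulrCA.
  apply: le_trans (ler_wpM2l (ltW eps0) l2) _; rewrite mulrCA.
  by rewrite ler_wpM2l ?ler0n.
by rewrite -[K.+2]addn2 natrD mulrDl; move: P1; rewrite -/P; lra.
Qed.

Theorem theorem1 (R : realType) (d : nat) (d_ge4 : (4 <= d)%N)
    (d_even : ~~ odd d) (p : \bar R)
    (p_ge : (((12 * d%:R - 8) / (9 * d%:R - 12))%:E <= p)%E) :
  forall eps : R, 0 < eps ->
  exists C : R,
  forall (F : finFieldType) (F_odd : odd #|F|)
    (chi : F -> R[i]) (chi_nontrivial : nontrivial_additive_character chi)
    (j : F) (j_neq0 : j != 0),
    (Rstar chi d j p 4%:E <= (C * #|F|%:R `^ eps)%:E)%E /\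
    forall f : sphere_pt d j -> R[i],
      Lnorm_counting 4%:E (extension chi f)
        <= C * #|F|%:R `^ eps * Lnorm_surface p f.
Proof.
move=> eps eps0.
have dE : d = (d./2).*2 by rewrite -[LHS]odd_double_half (negPf d_even).
move: d_ge4 p_ge; rewrite {d_even}dE; move: (d./2) => h; rewrite (leq_double 2 h) => h2.
set p0 := (_ / _) => p_ge.
have d4 : 4 <= (h.*2)%:R :> R by rewrite ler_nat (leq_double 2).
have D1 : 0 < 9 * (h.*2)%:R - 12 :> R by lra.
have D2 : 0 < 3 * (h.*2)%:R - 2 :> R by lra.
have D3 : 0 < 12 * (h.*2)%:R - 8 :> R by lra.
have p00 : 0 < p0 by rewrite divr_gt0.
(* 15 is the loss in [dyadic_fourth_moment]; the other factor comes from the number of levels. *)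
pose C : R := 15 * (2 + (h.*2)%:R / (eps * ln 2)).
have C0 : 0 <= C.
  rewrite mulr_ge0 ?ler0n // addr_ge0 ?ler0n // divr_ge0 ?ler0n //.
  by rewrite mulr_ge0 ?(ltW eps0) // ln_ge0 // ler1n.
exists C => F F_odd chi chi_nontrivial j j_neq0.
suff main : forall f : sphere_pt h.*2 j -> R[i], Lnorm_counting 4%:E (extension chi f)
    <= C * #|F|%:R `^ eps * Lnorm_surface p f.
  split=> //; apply: ereal_inf_lbound; exists (C * #|F|%:R `^ eps) => //.
  by split=> //; rewrite mulr_ge0 // powR_ge0.
move=> f; set B := Lnorm_surface p f.
(* The least [K] with [2 ^ K >= q ^ d], as the bottom level requires. *)
pose K := up_log 2 (#|F| ^ h.*2).
have F0 : (0 < #|F|)%N by apply/card_gt0P; exists 0.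
have qK : #|F|%:R ^+ h.*2 <= 2 ^+ K :> R by rewrite -!natrX ler_nat up_logP.
have HB (E : {set 'rV[F]_h.*2}) (a : R) : 0 <= a -> E \subset sphere h.*2 j ->
    {in E, forall x, a <= Normc.normc (zero_extension f x)} ->
    a * (#|E|%:R / #|sphere h.*2 j|%:R) `^
      ((9 * (h.*2)%:R - 12) / (3 * (h.*2)%:R - 2) / 4) <= B.
  move=> a0 ES aE; rewrite (_ : _ / 4 = p0^-1); first exact: Lnorm_surface_ge.
  by rewrite /p0; field; rewrite !gt_eqF.
have B0 : 0 <= B.
  have := HB set0 0 (lexx 0) (sub0set _) (fun x _ => normc_ge0 (zero_extension f x)).
  by rewrite mul0r.
have := dyadic_fourth_moment F_odd chi_nontrivial h2 j_neq0
  (@zero_extension_out _ _ _ _ f) HB qK.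
under eq_bigr do rewrite -extension_char_transform.
rewrite -exprMn /Lnorm_counting /Lnorm_weighted mul1r.
under [X in X `^ _ <= _]eq_bigr do rewrite powR_mulrn ?normc_ge0 //.
set X := \sum_m _; set Y := K.+1%:R * _ => XY.
have Y0 : 0 <= Y by rewrite mulr_ge0 ?ler0n // mulr_ge0 ?ler0n.
apply: le_trans (_ : Y <= _).
  apply: le_trans (ge0_ler_powR _ _ _ XY) _; rewrite ?invr_ge0 ?ler0n ?nnegrE ?exprn_ge0 //.
    by apply: sumr_ge0 => m _; exact: exprn_ge0 (normc_ge0 _).
  by rewrite -powR_mulrn // -powRrM mulfV ?pnatr_eq0 // powRr1.
rewrite /Y mulrA ler_wpM2r // mulrC /C -mulrA ler_wpM2l ?ler0n //.
exact: up_log2_le.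
Qed.
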